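(* Let $\mu_0$ be the logistic measure on $\mathbb{R}$, with density $\frac{1}{e^{\gamma}+e^{-\gamma}+2}$, and write $\Gamma(X)=\Gamma(X,\mu_0)$. (1) For every $n\ge 1$ and every non-empty set $X\subset\{0,1\}^n$, we have $$\ln|X|\le \Gamma(X).$$ (2) Let $$h(t)=\sup_{0\le\delta<1}\Bigl(\delta t+\ln\frac{\sin\pi\delta}{\pi\delta}\Bigr)\quad\text{for } t\ge 0,$$ where $\frac{\sin \pi\delta}{\pi\delta}$ is interpreted as $1$ at $\delta=0$. Then $h$ is a convex increasing function on $[0,+\infty)$, and for all integers $1\le k\le n$ and every non-empty family $X$ of $k$-subsets of $\{1,\ldots,n\}$, we have $$h(t)\le k^{-1}\ln|X|\quad\text{where}\quad t=k^{-1}\Gamma(X).$$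
   Context: Subsets $x$ of $\{1,\ldots,n\}$ are identified with their indicator vectors in $\{0,1\}^n$, so a family of subsets of $\{1,\ldots,n\}$ is a subset $X\subset\{0,1\}^n$. A $k$-subset is a subset with exactly $k$ elements. $|X|$ is the cardinality of $X$. For a symmetric Borel probability measure $\mu$ on $\mathbb{R}$ (i.e. $\mu(A)=\mu(-A)$ for all Borel $A$) with finite variance and a non-empty family $X\subset\{0,1\}^n$, $$\Gamma(X,\mu)=\mathbf{E}\max_{x\in X}\sum_{i\in x}\gamma_i,$$ where $\gamma_1,\ldots,\gamma_n$ are independent random variables with distribution $\mu$ (the sum over the empty set is $0$). *)

(* Defs.v *)
From mathcomp Require Import all_boot all_order all_algebra.
From mathcomp Require Import all_classical all_reals all_analysis.

Set Implicit Arguments.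
Unset Strict Implicit.
Unset Printing Implicit Defensive.

Import Order.TTheory GRing.Theory Num.Theory.
Import numFieldNormedType.Exports.

Local Open Scope classical_set_scope.
Local Open Scope ring_scope.

Definition logistic_pdf {R : realType} (x : R) : R :=
  (expR x + expR (- x) + 2)^-1.

Definition logistic_prob {R : realType} (A : set R) : \bar R :=
  (\int[lebesgue_measure]_(x in A) (logistic_pdf x)%:E)%E.

Definition mutually_independent (d : measure_display) (T : measurableType d)
    (R : realType) (P : probability T R) (n : nat)
    (g : 'I_n -> {RV P >-> R}) : Prop :=
  forall (J : {set 'I_n}) (A : 'I_n -> set R),
    (forall i, measurable (A i)) ->
    P (\bigcap_(i in [set` J]) (g i @^-1` A i)) =
      (\prod_(i in J) P (g i @^-1` A i))%E.
Arguments mutually_independent {d T R} P {n} g.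

Definition iid_sample (d : measure_display) (T : measurableType d)
    (R : realType) (P : probability T R) (n : nat)
    (mu : set R -> \bar R) (g : 'I_n -> {RV P >-> R}) : Prop :=
  mutually_independent P g /\
  forall i (A : set R), measurable A -> distribution P (g i) A = mu A.
Arguments iid_sample {d T R} P {n} mu g.

(* The maximum is taken in [\bar R], where -oo is neutral; it is a real number
   as soon as X is non-empty. *)
Definition max_weight (R : realType) (n : nat) (X : {set {set 'I_n}})
    (w : 'I_n -> R) : R :=
  fine (\big[maxe/-oo%E]_(x in X) (\sum_(i in x) w i)%:E).

(* Depends on the sample [g] only through its joint law, hence, for an i.i.d.
   sample of law mu, only on X and mu. *)
Definition Gamma (d : measure_display) (T : measurableType d)
    (R : realType) (P : probability T R) (n : nat)
    (g : 'I_n -> {RV P >-> R}) (X : {set {set 'I_n}}) : R :=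
  fine ('E_P[fun w => max_weight X (fun i => g i w)])%E.
Arguments Gamma {d T R} P {n} g X.

Definition sinc_pi {R : realType} (delta : R) : R :=
  if delta == 0 then 1 else sin (pi * delta) / (pi * delta).

(* The supremum is that of a non-empty set bounded above by t (for t >= 0). *)
Definition h {R : realType} (t : R) : R :=
  sup [set delta * t + ln (sinc_pi delta) | delta in `[0, 1[ ].

(* Main.v *)
Require Import Defs.
From HB Require Import structures.
From mathcomp Require Import all_boot all_order all_algebra.
From mathcomp Require Import all_classical all_reals all_analysis.
From mathcomp Require Import measurable_realfun ring lra.

Set Implicit Arguments.
Unset Strict Implicit.
Unset Printing Implicit Defensive.

Import Order.TTheory GRing.Theory Num.Theory.
Import numFieldNormedType.Exports.

Local Open Scope classical_set_scope.
Local Open Scope ring_scope.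

(** Let gamma be logistic, so that P(gamma > -s) = e^s / (1 + e^s).

    The first inequality rests on one exact formula: for all reals a and b,
      E max(a, b + gamma) = ln (e^a + e^b)
    (integral_pospart_logistic).  Split the family X at a coordinate j into the
    members that avoid j and those that contain it, the latter with j deleted.
    The maximal weight of X is max(A, B + gamma_j), where A and B are the
    maximal weights of the two parts and do not involve gamma_j.  Integrating
    gamma_j out and then applying Jensen to the convex function
    ln (e^A + e^B) gives
      Gamma(X) >= ln (e^Gamma(X0) + e^Gamma(X1))       (Gamma_split),
    which is exactly the recursion that |X| = |X0| + |X1| needs for
    |X| <= e^Gamma(X) by induction on the set of coordinates in use
    (card_le_expR_Gamma).

    For the second inequality, let M be the maximal weight and 0 <= a < 1.
    Jensen, the bound of a maximum by a sum and independence give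
      e^(a Gamma(X)) <= E e^(a M) <= sum_(x in X) E e^(a sum_(i in x) gamma_i)
                      = |X| (E e^(a gamma))^k           (expR_Gamma_le).
    Since E e^(a gamma) = pi a / sin (pi a), taking logarithms and the supremum
    over a is the claim.  The upper bound on E e^(a gamma) that this takes
    (logistic_mgf_sinc) is half of the reflection formula.  It is obtained by
    comparing two families of integrals whose recursions depend on a in
    reciprocal ways.  With p the logistic density,
      int e^(a x) p(x)^(m+1) dx   and   int_0^(pi/2) cos(2 a t) cos(t)^(2 m) dt
    are multiplied, when m - 1 is replaced by m, by factors whose dependence on
    a is 1 - a^2/m^2 for the first and 1/(1 - a^2/m^2) for the second.  The
    second integral is largest at a = 0, hence
      sin (pi a) / (pi a) <= prod_(m <= N) (1 - a^2/m^2);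
    convexity of a |-> e^(a x) bounds the first by 1 + a/N times its value at
    a = 0, hence E e^(a gamma) prod_(m <= N) (1 - a^2/m^2) <= 1 + a/N.
    Multiply and let N tend to infinity.

    Finally h is a supremum of affine functions, hence convex; h(0) <= 0 while
    h(t) > 0 for t > 0 because ln (sin (pi a) / (pi a)) = O(a^2), and a convex
    function with these two properties is strictly increasing on t >= 0. *)

(** * Integrals of derivatives over the line *)

Section ge0_linear.
Context d (T : measurableType d) (R : realType) (m : {measure set T -> \bar R}).

Lemma ge0_integral_lin (f g : T -> R) (a b : R) :
  measurable_fun setT f -> measurable_fun setT g ->
  (forall x, 0 <= f x) -> (forall x, 0 <= g x) -> 0 <= a -> 0 <= b ->
  (\int[m]_x (a * f x + b * g x)%:E =
   a%:E * \int[m]_x (f x)%:E + b%:E * \int[m]_x (g x)%:E)%E.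
Proof.
move=> mf mg f0 g0 a0 b0.
have mf' : measurable_fun setT (fun x => (f x)%:E) by exact/measurable_EFinP.
have mg' : measurable_fun setT (fun x => (g x)%:E) by exact/measurable_EFinP.
under eq_integral do rewrite EFinD 2!EFinM.
rewrite ge0_integralD//=.
- rewrite !ge0_integralZl_EFin//.
  + by move=> x _; rewrite lee_fin.
  + by move=> x _; rewrite lee_fin.
- by move=> x _; rewrite -EFinM lee_fin mulr_ge0.
- exact: measurable_funeM.
- by move=> x _; rewrite -EFinM lee_fin mulr_ge0.
- exact: measurable_funeM.
Qed.

End ge0_linear.

Section ftc_line.
Context {R : realType}.
Implicit Types (f F : R -> R).
Local Notation mu := (@lebesgue_measure R).

Lemma integral_segment_is_derive f F (a b : R) : a < b -> continuous f ->
  (forall x, is_derive x (1 : R) F (f x)) ->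
  (\int[mu]_(x in `[a, b]) (f x)%:E = (F b - F a)%:E)%E.
Proof.
move=> ab cf dF.
have cF : continuous F.
  move=> x; apply/differentiable_continuous/derivable1_diffP.
  exact: ex_derive.
rewrite EFinB; apply: continuous_FTC2 => //.
- exact: continuous_subspaceT.
- split => [x _| |].
  + exact: ex_derive.
  + exact/cvg_at_right_filter/cF.
  + exact/cvg_at_left_filter/cF.
- by move=> x _; rewrite derive1E derive_val.
Qed.

(** Improper form of the fundamental theorem for an integrand of varying sign:
    the derivative is split into two nonnegative parts, whose integrals over
    the line always make sense, even before either is known to be finite. *)
Lemma integral_line_is_derive f1 f2 F (l : R) :
  continuous f1 -> continuous f2 ->
  (forall x, 0 <= f1 x) -> (forall x, 0 <= f2 x) ->
  (forall x, is_derive x (1 : R) F (f1 x - f2 x)) ->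
  F n.+1%:R - F (- n.+1%:R) @[n --> \oo] --> l ->
  (\int[mu]_x (f1 x)%:E = \int[mu]_x (f2 x)%:E + l%:E)%E.
Proof.
move=> c1 c2 f10 f20 dF Fl.
pose I n : set R := `[- n.+1%:R, n.+1%:R]%classic.
have UI : \bigcup_n I n = setT.
  rewrite -subTset => x _; exists (Num.truncn `|x|) => //.
  rewrite /I /= in_itv/= -ler_norml; exact/ltW/truncnS_gt.
have ndI : nondecreasing_seq I.
  move=> m n mn; apply/subsetPset => x; rewrite /I /= !in_itv/= -!ler_norml.
  by move=> /le_trans; apply; rewrite ler_nat.
have mI n : measurable (I n) by exact: measurable_itv.
have mf f n : continuous f -> measurable_fun (I n) f.
  move=> cf; apply/measurable_funTS.
  exact: continuous_measurable_fun.
have cvgI f : continuous f -> (forall x, 0 <= f x) ->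
    (\int[mu]_(x in I n) (f x)%:E @[n --> \oo] --> \int[mu]_x (f x)%:E)%E.
  move=> cf f0; rewrite -UI; apply: ge0_nondecreasing_set_cvg_integral => //.
  - by move=> n; apply/measurable_EFinP; exact: mf.
  - by move=> n x _; rewrite lee_fin.
have intI f n : continuous f -> mu.-integrable (I n) (EFin \o f).
  move=> cf; apply: continuous_compact_integrable.
    exact: segment_compact.
  exact: continuous_subspaceT.
have ftcE n : (\int[mu]_(x in I n) (f1 x)%:E =
    \int[mu]_(x in I n) (f2 x)%:E + (F n.+1%:R - F (- n.+1%:R))%:E)%E.
  have c12 : continuous (f1 \- f2).
    by move=> x; apply: continuousB; [exact: c1|exact: c2].
  have n_lt : - n.+1%:R < n.+1%:R :> R by rewrite gtrN.
  rewrite -(integral_segment_is_derive n_lt c12 dF).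
  rewrite -integralD; [|exact: mI|exact: intI|exact: intI].
  by apply: eq_integral => x _; rewrite -EFinD addrC subrK.
have : (\int[mu]_(x in I n) (f1 x)%:E @[n --> \oo] --> \int[mu]_x (f2 x)%:E + l%:E)%E.
  rewrite (funext ftcE).
  apply: cvgeD.
  - by rewrite fin_num_adde_defl.
  - exact: cvgI.
  - by apply/cvg_EFin; [near=> n|].
by apply: cvg_unique => //; exact: cvgI.
Unshelve. all: by end_near. Qed.

Lemma integral_opp f : measurable_fun setT f -> (forall x, 0 <= f x) ->
  (\int[mu]_x (f (- x))%:E = \int[mu]_x (f x)%:E)%E.
Proof.
move=> mf f0.
transitivity (\int[mu]_(x in (-%R : _ -> measurableTypeR R) @^-1` setT)
    ((EFin \o f) \o -%R) x)%E.
  by rewrite preimage_setT.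
rewrite -ge0_integral_pushforward//=.
- by apply: eq_measure_integral => // A mA _; exact: lebesgue_measureN.
- by have /measurable_EFinP := mf.
- by move=> x _; rewrite lee_fin.
Qed.

End ftc_line.

(** * The logistic density *)

Section derive_lambda.
Context {R : realType}.
Implicit Types (f g : R -> R) (x a b : R).

(** The differentiation rules for lambda-abstractions, so that the derivative of
    an explicit expression is one term built from them.  In the rules for the
    inverse and the composition, the premise that determines the inner function
    comes first: unification could not guess it from the other one. *)
Lemma derD f g x a b : is_derive x 1 f a -> is_derive x 1 g b ->
  is_derive x 1 (fun y => f y + g y) (a + b).
Proof. by move=> fa gb; exact: is_deriveD. Qed.

Lemma derB f g x a b : is_derive x 1 f a -> is_derive x 1 g b ->
  is_derive x 1 (fun y => f y - g y) (a - b).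
Proof. by move=> fa gb; exact: is_deriveB. Qed.

Lemma derN f x a : is_derive x 1 f a -> is_derive x 1 (fun y => - f y) (- a).
Proof. by move=> fa; exact: is_deriveN. Qed.

Lemma der_eq f x a b : is_derive x 1 f a -> a = b -> is_derive x 1 f b.
Proof. by move=> fa <-. Qed.

Lemma derM f g x a b : is_derive x 1 f a -> is_derive x 1 g b ->
  is_derive x 1 (fun y => f y * g y) (a * g x + f x * b).
Proof.
move=> fa gb; apply: (der_eq (is_deriveM fa gb)).
by rewrite /GRing.scale/= addrC [g x * a]mulrC.
Qed.

Lemma derX f x a n : is_derive x 1 f a ->
  is_derive x 1 (fun y => f y ^+ n) (n%:R * f x ^+ n.-1 * a).
Proof.
move=> fa; have := is_deriveX n fa.
by rewrite (_ : f ^+ n = fun y => f y ^+ n)//; apply/funext => y; rewrite exprfctE.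
Qed.

Lemma derV f x a : is_derive x 1 f a -> f x != 0 ->
  is_derive x 1 (fun y => (f y)^-1) (- a / f x ^+ 2).
Proof.
move=> fa fx0; apply: (der_eq (is_deriveV fx0 fa)).
by rewrite /GRing.scale/= mulNr mulrC mulNr.
Qed.

Lemma der_comp f g x a b : is_derive x 1 g b -> is_derive (g x) 1 f a ->
  is_derive x 1 (fun y => f (g y)) (a * b).
Proof. by move=> gb fa; exact: is_derive1_comp. Qed.

Lemma der_scale x a : is_derive x 1 (fun y => a * y) a.
Proof.
apply: (der_eq (derM (is_derive_cst a x 1) (is_derive_id x 1))).
by rewrite mul0r add0r mulr1.
Qed.

Lemma der_expR_scale x a :
  is_derive x 1 (fun y => expR (a * y)) (a * expR (a * x)).
Proof.
apply: (der_eq (der_comp (der_scale x a) (is_derive_expR _))).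
by rewrite mulrC.
Qed.

Lemma der_expRN x : is_derive x 1 (fun y => expR (- y)) (- expR (- x)).
Proof.
apply: (der_eq (der_comp (is_deriveNid x 1) (is_derive_expR _))).
by rewrite mulrN1.
Qed.

Lemma is_derive_continuous f (f' : R -> R) :
  (forall x, is_derive x (1 : R) f (f' x)) -> continuous f.
Proof.
move=> df x; apply/differentiable_continuous/derivable1_diffP.
exact: ex_derive.
Qed.

End derive_lambda.

Section logistic_density.
Context {R : realType}.
Implicit Types x y : R.
Local Notation mu := (@lebesgue_measure R).
Local Notation p := (@logistic_pdf R).

Lemma logistic_pdfE x : p x = expR x / (1 + expR x) ^+ 2.
Proof.
rewrite /logistic_pdf expRN; have := expR_gt0 x; move: (expR x) => u u0.
have u1 : 1 + u != 0 by rewrite gt_eqF// ltr_wpDl.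
have -> : u + u^-1 + 2 = (1 + u) ^+ 2 / u by field; rewrite gt_eqF.
by rewrite invf_div.
Qed.

Lemma logistic_pdf_gt0 x : 0 < p x.
Proof. by rewrite invr_gt0 !addr_gt0 ?expR_gt0. Qed.

Lemma logistic_pdf_ge0 x : 0 <= p x. Proof. exact/ltW/logistic_pdf_gt0. Qed.

Lemma logistic_pdfN x : p (- x) = p x.
Proof. by rewrite /logistic_pdf opprK [expR (- x) + _]addrC. Qed.

Lemma is_derive_logistic_pdf x :
  is_derive x 1 p (- (expR x - expR (- x)) * p x ^+ 2).
Proof.
have D0 : expR x + expR (- x) + 2 != 0.
  by rewrite gt_eqF// !addr_gt0 ?expR_gt0.
apply: (der_eq (derV (derD (derD (is_derive_expR x) (der_expRN x))
  (is_derive_cst (2 : R) x 1)) D0)).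
by rewrite addr0 /logistic_pdf exprVn.
Qed.

Lemma continuous_logistic_pdf : continuous p.
Proof. by apply: is_derive_continuous => x; exact: is_derive_logistic_pdf. Qed.

Lemma measurable_logistic_pdf : measurable_fun setT p.
Proof. by apply: continuous_measurable_fun; exact: continuous_logistic_pdf. Qed.

Lemma logistic_pdf_mul_expR x : p x * expR `|x| <= 1.
Proof.
rewrite mulrC ler_pdivrMr ?mul1r; last by rewrite !addr_gt0 ?expR_gt0.
have := expR_ge0 x; have := expR_ge0 (- x).
case: (ger0P x) => _; lra.
Qed.

Lemma expR_half_ge (t : R) : t <= 2 * expR (t / 2).
Proof. have := expR_ge1Dx (t / 2); lra. Qed.

Lemma cvg_expRN_scale (a : R) : 0 < a ->
  expR (- (a * x)) @[x --> +oo] --> (0 : R).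
Proof.
move=> a0.
apply: (@cvg_comp _ _ _ (fun x => a * x) (fun x => expR (- x)));
  last exact: cvgr_expR.
by apply: gt0_cvgMry => //; exact: cvg_id.
Qed.

(** The identity behind the lower bound: E max(0, x + gamma) = ln (1 + e^x).
    The primitive used is the one that vanishes at infinity, namely
    -(x + y) P(gamma > y) - ln (1 + e^(-y)); at y = -x it equals
    -ln (1 + e^x). *)
Lemma integral_pospart_logistic x :
  (\int[mu]_y (Num.max (x + y) 0 * p y)%:E = (ln (1 + expR x))%:E)%E.
Proof.
pose G y := - ((x + y) / (1 + expR y)) - ln (1 + expR (- y)).
have e0 y : 0 < 1 + expR y by rewrite addr_gt0 ?expR_gt0.
have dG y : is_derive y 1 G ((x + y) * p y).
  have u0 : 1 + expR y != 0 by rewrite gt_eqF.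
  apply: (der_eq (derB (derN (derM
    (derD (is_derive_cst x y 1) (is_derive_id y 1))
    (derV (derD (is_derive_cst (1 : R) y 1) (is_derive_expR y)) u0)))
    (der_comp (derD (is_derive_cst (1 : R) y 1) (der_expRN y))
              (is_derive1_ln (e0 (- y)))))).
  rewrite /cst/= logistic_pdfE expRN; have := expR_gt0 y; have := e0 y.
  move: (expR y) u0 => u _ u1 {}u0.
  by field; rewrite !gt_eqF.
transitivity (\int[mu]_(y in `[(- x)%R, +oo[) ((x + y) * p y)%:E)%E.
  rewrite [RHS]integral_mkcond; apply: eq_integral => y _.
  rewrite patchE mem_setE in_itv/= andbT -subr_ge0 opprK addrC.
  case: ifPn => [yx|]; first by rewrite max_l.
  by rewrite -ltNge => yx; rewrite max_r ?mul0r// ltW.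
rewrite (@ge0_continuous_FTC2y _ _ G _ 0).
- by rewrite /G opprK addrN mul0r oppr0 !sub0r -EFinB sub0r opprK.
- move=> y xy; rewrite mulr_ge0 ?logistic_pdf_ge0//; lra.
- apply: continuous_subspaceT => y.
  apply: continuousM; last exact: continuous_logistic_pdf.
  by apply: continuousD; [exact: cst_continuous|exact: cvg_id].
- (* for x + y >= 0, both terms of - G are nonnegative and decay exponentially,
     since x + y <= 2 e^((x + y) / 2) *)
  pose lb y : R := - (2 * expR (x / 2) * expR (- (2^-1 * y)) + expR (- y)).
  apply: (@squeeze_cvgr _ _ _ _ lb (cst 0)); last exact: cvg_cst.
    near=> y.
    have xy : 0 <= x + y.
      by rewrite -lerBlDl; near: y; apply: nbhs_pinfty_ge; exact: num_real.
    have A : (x + y) / (1 + expR y) <= 2 * expR (x / 2) * expR (- (2^-1 * y)).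
      rewrite ler_pdivrMr//; apply: le_trans (expR_half_ge _) _.
      have -> : expR ((x + y) / 2) =
          expR (x / 2) * expR (- (2^-1 * y)) * expR y.
        by rewrite -!expRD; congr expR; field.
      by rewrite !mulrA mulrDr mulr1 lerDr !mulr_ge0 ?expR_ge0.
    have B : ln (1 + expR (- y)) <= expR (- y).
      by apply: le_ln1Dx; rewrite (lt_le_trans _ (expR_ge0 _)).
    have C : 0 <= (x + y) / (1 + expR y) by rewrite divr_ge0// ltW.
    have D : 0 <= ln (1 + expR (- y)) by rewrite ln_ge0// lerDl expR_ge0.
    by rewrite /G /lb /cst; apply/andP; split; lra.
  rewrite -[X in _ --> X]oppr0; apply: cvgN; rewrite -[X in _ --> X]addr0.
  apply: cvgD; last exact: cvgr_expR.
  rewrite -[X in _ --> X](mulr0 (2 * expR (x / 2))); apply: cvgMr.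
  by apply: cvg_expRN_scale; rewrite invr_gt0.
- by move=> y _; exact: ex_derive.
- exact/cvg_at_right_filter/(is_derive_continuous dG).
- by move=> y _; rewrite derive1E derive_val.
Unshelve. all: by end_near. Qed.

End logistic_density.

(** * Exponential moments of powers of the logistic density *)

Section logistic_moments.
Context {R : realType}.
Implicit Types x : R.
Local Notation mu := (@lebesgue_measure R).
Local Notation p := (@logistic_pdf R).

(** The Beta integral B(n + a, n - a) in the variable x = ln (u / (1 - u)); for
    n = 1 it is E e^(a gamma).  It is extended-real so that the recursion can
    be stated before finiteness, which follows from it. *)
Definition tilted_moment (n : nat) (a : R) : \bar R :=
  (\int[mu]_x (expR (a * x) * p x ^+ n)%:E)%E.

Lemma continuous_tilt (n : nat) (a : R) :
  continuous (fun x => expR (a * x) * p x ^+ n).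
Proof.
have dt (x : R) := derM (der_expR_scale x a) (derX n (is_derive_logistic_pdf x)).
exact: is_derive_continuous dt.
Qed.

Lemma measurable_tilt (n : nat) (a : R) :
  measurable_fun setT (fun x => expR (a * x) * p x ^+ n).
Proof. by apply: continuous_measurable_fun; exact: continuous_tilt. Qed.

Lemma tilt_ge0 (n : nat) (a x : R) : 0 <= expR (a * x) * p x ^+ n.
Proof. by rewrite mulr_ge0 ?expR_ge0 ?exprn_ge0 ?logistic_pdf_ge0. Qed.

Lemma logistic_pdf_le1 x : p x <= 1.
Proof.
apply: le_trans (logistic_pdf_mul_expR x).
by rewrite ler_peMr ?logistic_pdf_ge0// -expR0 ler_expR.
Qed.

Lemma cvgr_nS : (n.+1%:R : R) @[n --> \oo] --> +oo.
Proof. by rewrite (cvg_shiftS (fun n => n%:R : R)); exact: cvgr_idn. Qed.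

Lemma integral_logistic_pdf : (\int[mu]_x (p x)%:E = 1)%E.
Proof.
pose F x : R := - (1 + expR x)^-1.
have e0 x : 0 < 1 + expR x by rewrite addr_gt0 ?expR_gt0.
have dF x : is_derive x 1 F (p x - 0).
  have u0 : 1 + expR x != 0 by rewrite gt_eqF.
  apply: (der_eq (derN (derV (derD (is_derive_cst (1 : R) x 1)
    (is_derive_expR x)) u0))).
  rewrite /cst/= logistic_pdfE; have := e0 x; have := expR_gt0 x.
  by move: (expR x) => u u1 {}u0; field; rewrite gt_eqF.
rewrite (integral_line_is_derive _ _ _ _ dF (l := 1)).
- by rewrite integral0 add0e.
- exact: continuous_logistic_pdf.
- exact: cst_continuous.
- exact: logistic_pdf_ge0.
- by [].
rewrite [X in X @ _ --> _](_ : _ = fun n => 1 - 2 * (1 + expR n.+1%:R)^-1).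
  rewrite -[X in _ --> X]subr0; apply: cvgB; first exact: cvg_cst.
  rewrite -[X in _ --> X](mulr0 2); apply: cvgMr.
  apply: (@squeeze_cvgr _ _ _ _ (cst 0) (fun n : nat => expR (- (1 * n.+1%:R)))).
  - near=> n; apply/andP; split; first by rewrite /cst invr_ge0 ltW.
    by rewrite mul1r expRN lef_pV2 ?posrE ?expR_gt0// lerDr.
  - exact: cvg_cst.
  - exact: (cvg_comp _ _ cvgr_nS (cvg_expRN_scale ltr01)).
apply/funext => n; rewrite /F expRN.
have := e0 n.+1%:R; have := expR_gt0 (n.+1%:R : R).
by move: (expR _) => u u0 u1; field; rewrite !gt_eqF.
Unshelve. all: by end_near. Qed.

(** With q = e^x - e^(-x), the function e^(a x) (a p^m + m q p^(m+1)) vanishes at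
    both ends and its derivative is the difference of the two integrands,
    because p' = - q p^2, q' p = 1 - 2 p and q^2 p^2 = 1 - 4 p. *)
Lemma tilted_moment_rec (n : nat) (a : R) : 0 <= a < 1 ->
  ((2 * n.+1%:R * (2 * n.+1%:R + 1))%:E * tilted_moment n.+2 a =
   (n.+1%:R ^+ 2 - a ^+ 2)%:E * tilted_moment n.+1 a)%E.
Proof.
move=> /andP[a0 a1].
have m1 : 1 <= n.+1%:R :> R by rewrite ler1n.
have ma0 : 0 <= n.+1%:R ^+ 2 - a ^+ 2.
  by rewrite subr_ge0 lerXn2r ?nnegrE ?ler0n// (le_trans (ltW a1)).
pose m : R := n.+1%:R; pose q x : R := expR x - expR (- x).
have dq x : is_derive x 1 q (expR x + expR (- x)).
  by apply: (der_eq (derB (is_derive_expR x) (der_expRN x))); rewrite opprK.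
pose F x := expR (a * x) * (a * p x ^+ n.+1 + m * (q x * p x ^+ n.+2)).
have dF x : is_derive x 1 F
    (2 * m * (2 * m + 1) * (expR (a * x) * p x ^+ n.+2) -
     (m ^+ 2 - a ^+ 2) * (expR (a * x) * p x ^+ n.+1)).
  have dp := is_derive_logistic_pdf x.
  apply: (der_eq (derM (der_expR_scale x a) (derD
    (derM (is_derive_cst a x 1) (derX n.+1 dp))
    (derM (is_derive_cst m x 1) (derM (dq x) (derX n.+2 dp)))))).
  rewrite /cst/= /q !exprS; move: (p x ^+ n) (expR (a * x)) => P E.
  rewrite -[n.+2%:R]natr1 -/m logistic_pdfE expRN.
  have := expR_gt0 x; move: (expR x) => u u0.
  by field; rewrite !gt_eqF// ltr_wpDl.
(* p <= e^(-|x|) and |q p| <= 1, so F decays exponentially because a < 1 *)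
have nF x : `|F x| <= (1 + m) * expR (- ((1 - a) * `|x|)).
  have p0 := logistic_pdf_ge0 x; have p1 := logistic_pdf_le1 x.
  have q1 : `|q x * p x| <= 1.
    have D0 : 0 < expR x + expR (- x) + 2 by rewrite !addr_gt0 ?expR_gt0.
    rewrite normrM (ger0_norm p0) ler_pdivrMr// mul1r.
    have := expR_ge0 x; have := expR_ge0 (- x); rewrite /q ler_norml; lra.
  have A : `|a * p x ^+ n.+1 + m * (q x * p x ^+ n.+2)| <= (1 + m) * p x.
    have P0 k : 0 <= p x ^+ k by rewrite exprn_ge0.
    have P1 k : p x ^+ k <= 1 by rewrite exprn_ile1.
    rewrite [leRHS]mulrDl mul1r (le_trans (ler_normD _ _))// lerD//.
      rewrite normrM !ger0_norm// exprS mulrCA ler_piMr//.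
      by rewrite mulr_ile1// ltW.
    have -> : q x * p x ^+ n.+2 = p x * (q x * p x * p x ^+ n).
      by rewrite !exprS; ring.
    rewrite 2!normrM ger0_norm ?ler0n// (ger0_norm p0) ler_wpM2l ?ler0n//.
    by rewrite ler_piMr// normrM mulr_ile1// ger0_norm.
  rewrite normrM ger0_norm ?expR_ge0//.
  apply: le_trans (ler_wpM2l (expR_ge0 _) A) _.
  rewrite mulrCA ler_wpM2l ?addr_ge0 ?ler0n//.
  have -> : expR (- ((1 - a) * `|x|)) = expR (a * `|x|) * expR (- `|x|).
    by rewrite -expRD; congr expR; ring.
  rewrite ler_pM ?expR_ge0 ?ler_expR ?ler_wpM2l ?ler_norm//.
  rewrite expRN -[leRHS]mul1r ler_pdivlMr ?expR_gt0//.
  exact: logistic_pdf_mul_expR.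
rewrite /tilted_moment -!ge0_integralZl_EFin//; last 4 first.
- by move=> x _; rewrite lee_fin tilt_ge0.
- by apply/measurable_EFinP; exact: measurable_tilt.
- by move=> x _; rewrite lee_fin tilt_ge0.
- by apply/measurable_EFinP; exact: measurable_tilt.
under eq_integral do rewrite -EFinM.
under [RHS]eq_integral do rewrite -EFinM.
rewrite (integral_line_is_derive _ _ _ _ dF (l := 0)) ?adde0//.
- by move=> x; apply: cvgMr; exact: (continuous_tilt (a := a)).
- by move=> x; apply: cvgMr; exact: (continuous_tilt (a := a)).
- move=> x; rewrite mulr_ge0 ?tilt_ge0//.
  by rewrite mulr_ge0 ?addr_ge0 ?mulr_ge0 ?ler0n.
- by move=> x; rewrite mulr_ge0 ?tilt_ge0.
apply/cvgr0Pnorm_le => e e0.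
have C0 : (1 + m) * expR (- ((1 - a) * n.+1%:R)) +
    (1 + m) * expR (- ((1 - a) * n.+1%:R)) @[n --> \oo] --> (0 : R).
  rewrite -[X in _ --> X]addr0.
  suff C : (1 + m) * expR (- ((1 - a) * n.+1%:R)) @[n --> \oo] --> (0 : R).
    exact: cvgD.
  rewrite -[X in _ --> X](mulr0 (1 + m)); apply: cvgMr.
  have a1' : 0 < 1 - a by rewrite subr_gt0.
  exact: (cvg_comp _ _ cvgr_nS (cvg_expRN_scale a1')).
move/cvgr0Pnorm_le : C0 => /(_ _ e0); apply: filterS => k.
apply: le_trans; apply: le_trans (ler_normB _ _) _.
apply: le_trans (lerD (nF _) (nF _)) _.
by rewrite normrN ger0_norm ?ler0n// ler_norm.
Qed.

End logistic_moments.

Section logistic_laplace.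
Context {R : realType}.
Implicit Types x : R.
Local Notation mu := (@lebesgue_measure R).
Local Notation p := (@logistic_pdf R).

(** The partial products of Euler's product for sin (pi a) / (pi a). *)
Definition euler_prod (N : nat) (a : R) : R :=
  \prod_(i < N) (1 - (a / i.+1%:R) ^+ 2).

Lemma euler_prod_gt0 (N : nat) (a : R) : 0 <= a < 1 -> 0 < euler_prod N a.
Proof.
move=> /andP[a0 a1]; apply: prodr_gt0 => i _.
rewrite subr_gt0 expr_lt1 ?divr_ge0// ltr_pdivrMr ?mul1r ?ltr0n//.
by rewrite (lt_le_trans a1)// ler1n.
Qed.

Lemma euler_prodS (N : nat) (a : R) :
  euler_prod N.+1 a = euler_prod N a * (1 - (a / N.+1%:R) ^+ 2).
Proof. by rewrite /euler_prod big_ord_recr. Qed.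

(** Convexity of exp between 0 and x, from the tangent at a x. *)
Lemma expR_chord (a x : R) : 0 <= a <= 1 ->
  expR (a * x) <= 1 - a + a * expR x.
Proof.
move=> /andP[a0 a1].
have A : expR (a * x) * (1 - a * x) <= 1.
  rewrite -[leRHS]expR0 -[X in _ <= expR X](subrr (a * x)) expRD.
  by rewrite ler_pM2l ?expR_gt0// expR_ge1Dx.
have B : expR (a * x) * (1 + (1 - a) * x) <= expR x.
  rewrite [in leRHS](_ : x = a * x + (1 - a) * x); last by ring.
  by rewrite expRD ler_pM2l ?expR_gt0// expR_ge1Dx.
have a1' : 0 <= 1 - a by rewrite subr_ge0.
have := lerD (ler_wpM2l a1' A) (ler_wpM2l a0 B); rewrite mulr1.
by apply: le_trans; rewrite le_eqVlt; apply/orP; left; apply/eqP; ring.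
Qed.

Lemma tilted_moment_ge0 n (a : R) : (0 <= tilted_moment n a)%E.
Proof. by apply: integral_ge0 => x _; rewrite lee_fin tilt_ge0. Qed.

Lemma tilted_moment10 : tilted_moment 1 (0 : R) = 1%E.
Proof.
rewrite -integral_logistic_pdf; apply: eq_integral => x _.
by rewrite mul0r expR0 mul1r expr1.
Qed.

Lemma tilted_momentN n (a : R) : tilted_moment n (- a) = tilted_moment n a.
Proof.
rewrite /tilted_moment -(integral_opp (measurable_tilt n a) (tilt_ge0 n a)).
by apply: eq_integral => x _; rewrite mulrN mulNr logistic_pdfN.
Qed.

Lemma le_tilted_moment n m (a b : R) :
  (forall x, expR (a * x) * p x ^+ n <= expR (b * x) * p x ^+ m) ->
  (tilted_moment n a <= tilted_moment m b)%E.
Proof.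
move=> ab; apply: ge0_le_integral => //.
- by move=> x _; rewrite lee_fin tilt_ge0.
- by apply/measurable_EFinP; exact: measurable_tilt.
- by apply/measurable_EFinP; exact: measurable_tilt.
- by move=> x _; rewrite lee_fin.
Qed.

(** As e^(a x) p <= 1, the integral for the power p^2 is at most the total mass;
    the recursion transfers finiteness to the power p, and p <= 1 from there to
    all the others. *)
Lemma tilted_moment_fin n (a : R) : 0 <= a < 1 ->
  tilted_moment n.+1 a \is a fin_num.
Proof.
move=> a01; have /andP[a0 a1] := a01.
have I2 : (tilted_moment 2 a <= 1)%E.
  rewrite -tilted_moment10; apply: le_tilted_moment => x.
  rewrite mul0r expR0 mul1r expr1 exprS expr1 mulrA ler_piMl ?logistic_pdf_ge0//.
  apply: le_trans (logistic_pdf_mul_expR x); rewrite mulrC.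
  rewrite ler_wpM2l ?logistic_pdf_ge0// ler_expR.
  apply: le_trans (ler_norm _) _; rewrite normrM ger0_norm// ler_piMl//.
  exact: ltW.
have I1 : tilted_moment 1 a \is a fin_num.
  rewrite ge0_fin_numE ?tilted_moment_ge0//.
  have := tilted_moment_rec 0 a01; rewrite expr1n mulr1.
  have c0 : 0 < 1 - a ^+ 2 by rewrite subr_gt0 expr_lt1.
  move=> E; rewrite -(@lte_pmul2l _ (1 - a ^+ 2)%:E) ?lte_fin// -E.
  rewrite gt0_muley ?lte_fin//; apply: lte_mul_pinfty => //.
  exact: le_lt_trans I2 (ltry _).
rewrite ge0_fin_numE ?tilted_moment_ge0//.
apply: le_lt_trans (_ : tilted_moment 1 a < +oo)%E.
  apply: le_tilted_moment => x; rewrite ler_wpM2l ?expR_ge0//.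
  rewrite exprS expr1 ler_piMr ?logistic_pdf_ge0// exprn_ile1//.
    exact: logistic_pdf_ge0.
  exact: logistic_pdf_le1.
by rewrite -ge0_fin_numE ?tilted_moment_ge0.
Qed.

Let r n (a : R) := fine (tilted_moment n a).

Let r_rec (n : nat) (a : R) : 0 <= a < 1 ->
  2 * n.+1%:R * (2 * n.+1%:R + 1) * r n.+2 a =
  (n.+1%:R ^+ 2 - a ^+ 2) * r n.+1 a.
Proof.
move=> a01; have := tilted_moment_rec n a01.
rewrite -[tilted_moment n.+2 a]fineK ?tilted_moment_fin//.
rewrite -[tilted_moment n.+1 a]fineK ?tilted_moment_fin//.
by rewrite -!EFinM => -[].
Qed.

Let zero01 : 0 <= (0 : R) < 1. Proof. by rewrite lexx ltr01. Qed.

Let r_prod (N : nat) (a : R) : 0 <= a < 1 ->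
  r N.+1 a = r N.+1 0 * euler_prod N a * r 1 a.
Proof.
move=> a01; elim: N => [|N IH].
  by rewrite /euler_prod big_ord0 mulr1 /r tilted_moment10 mul1r.
have c0 : 2 * N.+1%:R * (2 * N.+1%:R + 1) != 0 :> R.
  by rewrite gt_eqF// mulr_gt0 ?mulr_gt0 ?ltr0n// ltr_wpDl// mulr_ge0// ler0n.
apply: (mulfI c0); rewrite r_rec// IH !mulrA r_rec// euler_prodS.
have n0 : N.+1%:R != 0 :> R by rewrite pnatr_eq0.
by field.
Qed.

Let r0_gt0 (N : nat) : 0 < r N.+1 0.
Proof.
elim: N => [|N IH]; first by rewrite /r tilted_moment10.
have := r_rec N zero01; rewrite [0 ^+ 2]expr0n subr0 => E.
have : 0 < N.+1%:R ^+ 2 * r N.+1 0 by rewrite mulr_gt0// exprn_gt0 ?ltr0n.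
have c0 : 0 < 2 * N.+1%:R * (2 * N.+1%:R + 1) :> R.
  by rewrite mulr_gt0 ?mulr_gt0 ?ltr0n// ltr_wpDl// mulr_ge0// ler0n.
by rewrite -E pmulr_rgt0.
Qed.

(** Replace e^(a x) by its chord 1 - a + a e^x.  By the symmetry of p, the
    integral of e^x p^(N+2) is half that of (e^x + e^(-x)) p^(N+2), and
    e^x + e^(-x) = 1/p - 2 turns it into moments at a = 0, which the recursion
    compares. *)
Let r_le (N : nat) (a : R) : 0 <= a < 1 ->
  r N.+2 a <= r N.+2 0 * (1 + a / N.+1%:R).
Proof.
move=> a01; have /andP[a0 a1] := a01.
pose K := tilted_moment N.+2 (1 : R).
pose f (c x : R) : R := expR (c * x) * p x ^+ N.+2.
have mf (c : R) : measurable_fun setT (f c) by exact: measurable_tilt.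
have f0 (c x : R) : 0 <= f c x by exact: tilt_ge0.
have KE : (K + K + 2%:E * tilted_moment N.+2 (0 : R) = tilted_moment N.+1 (0 : R))%E.
  transitivity (\int[mu]_x (1 * (1 * f 1 x + 1 * f (- 1) x) + 2 * f 0 x)%:E)%E.
    rewrite !ge0_integral_lin//; last 5 first.
    - exact: mf.
    - exact: mf.
    - by apply: measurable_funD; apply: measurable_funM => //; exact: mf.
    - exact: mf.
    - by move=> x; rewrite addr_ge0// mul1r.
    have -> : (\int[mu]_x (f (- 1)%R x)%:E = K)%E := tilted_momentN N.+2 1.
    rewrite -[(\int[mu]_x (f 1%R x)%:E)%E]/K.
    rewrite -[(\int[mu]_x (f 0%R x)%:E)%E]/(tilted_moment N.+2 0).
    by move: K (tilted_moment N.+2 0) => k1 k2; rewrite !mul1e.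
  apply: eq_integral => x _; rewrite /f; congr EFin.
  rewrite !mul1r mulN1r !mul0r !expR0 !exprS; move: (p x ^+ N) => P.
  have D0 : expR x + expR (- x) + 2 != 0 by rewrite gt_eqF// !addr_gt0 ?expR_gt0.
  by rewrite /logistic_pdf; field.
have Kfin : K \is a fin_num.
  rewrite ge0_fin_numE ?tilted_moment_ge0//.
  apply: (@le_lt_trans _ _ (tilted_moment N.+1 (0 : R))).
    rewrite -KE -addeA leeDl// adde_ge0 ?mule_ge0 ?tilted_moment_ge0//.
  by rewrite -ge0_fin_numE ?tilted_moment_ge0// tilted_moment_fin.
have rK n b : 0 <= b < 1 -> (r n.+1 b)%:E = tilted_moment n.+1 b.
  by move=> b01; rewrite fineK ?tilted_moment_fin.
have {KE} KE : 2 * fine K + 2 * r N.+2 0 = r N.+1 0.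
  move: KE; rewrite -(fineK Kfin) -!rK// -EFinM -!EFinD => -[<-].
  by congr (_ + _); rewrite /=; move: (fine K) => k; ring.
have chord : r N.+2 a <= (1 - a) * r N.+2 0 + a * fine K.
  have a1' : 0 <= 1 - a by rewrite subr_ge0 ltW.
  have r2E := rK N.+1 0 zero01; have raE := rK N.+1 a a01.
  have kE := fineK Kfin.
  rewrite -lee_fin raE.
  have -> : ((1 - a) * r N.+2 0 + a * fine K)%:E =
      ((1 - a)%:E * tilted_moment N.+2 0 + a%:E * K)%E.
    by rewrite -r2E -[in RHS]kE -!EFinM -EFinD.
  apply: (@le_trans _ _ (\int[mu]_x ((1 - a) * f 0 x + a * f 1 x)%:E)%E).
    apply: ge0_le_integral => //.
    - by move=> x _; rewrite lee_fin tilt_ge0.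
    - by apply/measurable_EFinP; exact: mf.
    - apply/measurable_EFinP.
      by apply: measurable_funD; apply: measurable_funM => //; exact: mf.
    - move=> x _; rewrite /f lee_fin mul0r mul1r expR0.
      move: (p x ^+ N.+2) (exprn_ge0 N.+2 (logistic_pdf_ge0 x)) => P P0.
      have -> : (1 - a) * (1 * P) + a * (expR x * P) =
        (1 - a + a * expR x) * P by ring.
      by rewrite ler_wpM2r ?exprn_ge0 ?logistic_pdf_ge0// expR_chord// a0 ltW.
  by rewrite ge0_integral_lin//; exact: mf.
have := r_rec N zero01; rewrite [0 ^+ 2]expr0n subr0 => rec.
have n0 : N.+1%:R != 0 :> R by rewrite pnatr_eq0.
have {rec} rec : r N.+1 0 = 2 * (2 * N.+1%:R + 1) / N.+1%:R * r N.+2 0.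
  apply: (mulfI (_ : N.+1%:R ^+ 2 != 0)); first by rewrite expf_neq0.
  by rewrite -rec; field.
apply: le_trans chord _; rewrite le_eqVlt; apply/orP; left; apply/eqP.
move: (fine K) (r N.+1 0) (r N.+2 0) KE rec => k r1 r2 + r1E.
rewrite {}r1E => kE.
have -> : k = (2 * N.+1%:R + 1) / N.+1%:R * r2 - r2.
  by apply: (@mulfI _ 2) => //; rewrite -[LHS](addrK (2 * r2)) kE; field.
by field.
Qed.

Lemma tilted_moment_euler_prod (N : nat) (a : R) : 0 <= a < 1 ->
  fine (tilted_moment 1 a) * euler_prod N.+1 a <= 1 + a / N.+1%:R.
Proof.
move=> a01; have := r_le N a01.
by rewrite r_prod// -mulrA ler_pM2l ?r0_gt0// mulrC.
Qed.

End logistic_laplace.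

Section sinc_euler.
Context {R : realType}.
Implicit Types x a : R.
Local Notation mu := (@lebesgue_measure R).

Let S n a : R :=
  (\int[mu]_(x in `[0%R, (pi / 2)%R]) (cos (2 * a * x) * cos x ^+ (2 * n)))%R.

Let dcos n a x : is_derive x 1 (fun x => cos (2 * a * x) * cos x ^+ n)
  (- sin (2 * a * x) * (2 * a) * cos x ^+ n +
   cos (2 * a * x) * (n%:R * cos x ^+ n.-1 * - sin x)).
Proof.
exact: (derM (der_comp (der_scale x (2 * a)) (is_derive_cos _))
             (derX n (is_derive_cos x))).
Qed.

Let ccos n a : continuous (fun x => cos (2 * a * x) * cos x ^+ n).
Proof. exact: is_derive_continuous (dcos n a). Qed.

Let icos n a : mu.-integrable `[0, pi / 2]
  (EFin \o (fun x => cos (2 * a * x) * cos x ^+ n)).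
Proof.
apply: continuous_compact_integrable; first exact: segment_compact.
exact/continuous_subspaceT/ccos.
Qed.

Let pi2_gt0 : 0 < pi / 2 :> R. Proof. by rewrite divr_gt0 ?pi_gt0. Qed.

Let S_ftc (f F : R -> R) : continuous f -> (forall x, is_derive x 1 F (f x)) ->
  (\int[mu]_(x in `[0%R, (pi / 2)%R]) f x)%R = F (pi / 2) - F 0.
Proof.
by move=> cf dF; rewrite /Rintegral (integral_segment_is_derive pi2_gt0 cf dF).
Qed.

Let S0 a : S 0 a = pi / 2 * sinc_pi a.
Proof.
rewrite /S /sinc_pi; case: eqVneq => [->|a0].
  under eq_Rintegral do rewrite mulr0 mul0r cos0 muln0 expr0 mulr1.
  have c1 : continuous (fun _ : R => 1 : R) by exact: cst_continuous.
  rewrite (S_ftc c1 (fun x => is_derive_id x 1)).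
  by rewrite subr0 mulr1.
have a20 : 2 * a != 0 by rewrite mulf_neq0.
have dF x : is_derive x 1 (fun x => sin (2 * a * x) / (2 * a))
    (cos (2 * a * x) * cos x ^+ (2 * 0)).
  apply: (der_eq (derM (der_comp (der_scale x (2 * a)) (is_derive_sin _))
    (is_derive_cst (2 * a)^-1 x 1))).
  by rewrite mulr0 addr0 /cst muln0 expr0 mulr1 -mulrA divff ?mulr1.
rewrite (S_ftc (@ccos (2 * 0) a) dF) mulr0 sin0 mul0r subr0.
have -> : 2 * a * (pi / 2) = pi * a by field.
have pi0 : pi != 0 :> R by rewrite gt_eqF ?pi_gt0.
by move: (pi : R) pi0 => q q0; field; rewrite q0 a0.
Qed.

(** The integrand of the difference is the derivative of
    m cos(2 a t) cos(t)^(2m-1) sin t - a sin(2 a t) cos(t)^(2m), which vanishes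
    at 0 and at pi/2. *)
Let S_rec n a : 2 * (n.+1%:R ^+ 2 - a ^+ 2) * S n.+1 a =
  n.+1%:R * (2 * n.+1%:R - 1) * S n a.
Proof.
pose m : R := n.+1%:R.
pose F x := m * (cos (2 * a * x) * (cos x ^+ (2 * n).+1 * sin x)) -
  a * (sin (2 * a * x) * cos x ^+ (2 * n).+2).
have dF x : is_derive x 1 F
   (2 * (m ^+ 2 - a ^+ 2) * (cos (2 * a * x) * cos x ^+ (2 * n.+1)) -
   m * (2 * m - 1) * (cos (2 * a * x) * cos x ^+ (2 * n))).
  have dc := der_comp (der_scale x (2 * a)) (is_derive_cos _).
  have ds := der_comp (der_scale x (2 * a)) (is_derive_sin _).
  have dx k := derX k (is_derive_cos x).
  apply: (der_eq (derB
    (derM (is_derive_cst m x 1) (derM dc (derM (dx _) (is_derive_sin x))))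
    (derM (is_derive_cst a x 1) (derM ds (dx _))))).
  have e2 : (2 * n).+2%:R = 2 * m by rewrite /m -natrM mulnS.
  have e1 : (2 * n).+1%:R = 2 * m - 1 by rewrite -e2 -[in RHS]natr1 addrK.
  rewrite /cst/= mulnS !exprS e1 e2.
  move: (cos x ^+ (2 * n)) => P.
  have -> : m * (2 * m - 1) * (cos (2 * a * x) * P) =
    m * (2 * m - 1) * (cos (2 * a * x) * P) * (cos x ^+ 2 + sin x ^+ 2).
    by rewrite cos2Dsin2 mulr1.
  ring.
have cf k b : continuous (fun x => b * (cos (2 * a * x) * cos x ^+ k)).
  by move=> x; apply: cvgMr; exact: (@ccos k a).
have : 0 = F (pi / 2) - F 0.
  rewrite /F cos_pihalf sin0 !mulr0 sin0 !exprS !mul0r !mulr0; ring.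
rewrite -(S_ftc _ dF); last by move=> x; apply: cvgB; exact: cf.
rewrite RintegralB//=; last 2 first.
- apply: continuous_compact_integrable; first exact: segment_compact.
  exact/continuous_subspaceT/cf.
- apply: continuous_compact_integrable; first exact: segment_compact.
  exact/continuous_subspaceT/cf.
rewrite !RintegralZl//.
by move/eqP; rewrite eq_sym subr_eq0 => /eqP.
Qed.

Let S_prod n a : 0 <= a < 1 -> S n a * euler_prod n a = S n 0 * sinc_pi a.
Proof.
move=> a01; elim: n => [|n IH].
  by rewrite /euler_prod big_ord0 mulr1 !S0 /sinc_pi eqxx mulr1.
have n0 : n.+1%:R != 0 :> R by rewrite pnatr_eq0.
have E0 := S_rec n 0; have Ea := S_rec n a.
have c0 : 2 * n.+1%:R ^+ 2 != 0 :> R by rewrite mulf_neq0// expf_neq0.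
apply: (mulfI c0); rewrite euler_prodS.
transitivity ((2 * (n.+1%:R ^+ 2 - a ^+ 2) * S n.+1 a) * euler_prod n a).
  by field.
rewrite Ea -mulrA IH mulrA -E0 expr0n subr0; ring.
Qed.

Let S0_gt0 n : 0 < S n 0.
Proof.
elim: n => [|n IH]; first by rewrite S0 /sinc_pi eqxx mulr1.
have := S_rec n 0; rewrite expr0n subr0 => E.
have : 0 < n.+1%:R * (2 * n.+1%:R - 1) * S n 0.
  have n1 : 1 <= n.+1%:R :> R by rewrite ler1n.
  by rewrite mulr_gt0// mulr_gt0 ?ltr0n// subr_gt0; lra.
by rewrite -E pmulr_rgt0// mulr_gt0// exprn_gt0 ?ltr0n.
Qed.

Let S_le n a : S n a <= S n 0.
Proof.
apply: le_Rintegral => //.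
move=> x _; rewrite mulr0 mul0r cos0 ler_wpM2r ?cos_le1//.
by rewrite exprM exprn_ge0 ?sqr_ge0.
Qed.

(** The recursion gives S N a * euler_prod N a = S N 0 * sinc_pi a, and
    S N a <= S N 0 because cos (2 a t) <= 1. *)
Lemma sinc_pi_le_euler_prod N a : 0 <= a < 1 -> sinc_pi a <= euler_prod N a.
Proof.
move=> a01; rewrite -(ler_pM2l (S0_gt0 N)) -S_prod//.
by rewrite ler_wpM2r ?S_le// ltW ?euler_prod_gt0.
Qed.

End sinc_euler.

Section logistic_mgf.
Context {R : realType}.

Lemma sinc_pi_gt0 (a : R) : 0 <= a < 1 -> 0 < sinc_pi a.
Proof.
move=> /andP[a0 a1]; rewrite /sinc_pi; case: eqVneq => // a_neq0.
have a_gt0 : 0 < a by rewrite lt_neqAle eq_sym a_neq0.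
by rewrite divr_gt0 ?sin_gt0_pi ?mulr_gt0 ?pi_gt0//= -[ltRHS]mulr1 ltr_pM2l ?pi_gt0.
Qed.

Lemma sinc_pi_le1 (a : R) : 0 <= a < 1 -> sinc_pi a <= 1.
Proof.
by move=> /(sinc_pi_le_euler_prod 0); rewrite /euler_prod big_ord0.
Qed.

(** One half of the identity E e^(a gamma) = pi a / sin (pi a). *)
Lemma logistic_mgf_sinc (a : R) : 0 <= a < 1 ->
  fine (tilted_moment 1 a) * sinc_pi a <= 1.
Proof.
move=> a01; have /andP[a0 a1] := a01; apply/ler_addgt0Pr => e e0.
have [N Ne] : exists N : nat, N.+1%:R^-1 < e.
  exists (Num.truncn e^-1); rewrite invf_plt ?posrE//; exact: truncnS_gt.
apply: le_trans (_ : 1 + a / N.+1%:R <= _).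
  apply: le_trans (tilted_moment_euler_prod N a01).
  by rewrite ler_wpM2l ?fine_ge0 ?tilted_moment_ge0 ?sinc_pi_le_euler_prod.
rewrite lerD2l; apply: le_trans (ltW Ne).
by rewrite ler_piMl ?invr_ge0 ?ler0n// ltW.
Qed.

End logistic_mgf.

(** * The rate function *)

Section rate_function.
Context {R : realType}.
Implicit Types (s t a : R).

Lemma sin_le_id (y : R) : 0 <= y < pi -> sin y <= y.
Proof.
move=> /andP[y0 ypi]; have pi0 := @pi_gt0 R.
have [->|yn0] := eqVneq y 0; first by rewrite sin0.
have y_gt0 : 0 < y by rewrite lt_neqAle eq_sym yn0.
have a01 : 0 <= y / pi < 1 by rewrite divr_ge0 ?ltW//= ltr_pdivrMr ?mul1r.
have := sinc_pi_le1 a01; rewrite /sinc_pi.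
rewrite mulf_eq0 (negbTE yn0) invr_eq0 gt_eqF//= mulrCA divff ?gt_eqF// mulr1.
by rewrite ler_pdivrMr// mul1r.
Qed.

(** A crude form of sin y >= y - y^3/6: what matters is that sin y / y differs
    from 1 only at the second order. *)
Lemma sin_ge_cubic (y : R) : 0 <= y < pi -> y - y ^+ 3 <= sin y.
Proof.
move=> /andP[y0 ypi].
have [->|yn0] := eqVneq y 0; first by rewrite sin0 expr0n subr0.
have y_gt0 : 0 < y by rewrite lt_neqAle eq_sym yn0.
pose g x : R := sin x - (x - x ^+ 3).
have dg (x : R) : is_derive x 1 g (cos x - (1 - 3 * x ^+ 2)).
  apply: (der_eq (derB (is_derive_sin x)
    (derB (is_derive_id x 1) (derX 3 (is_derive_id x 1))))).
  by rewrite mulr1.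
have cg : {within `[0, y], continuous g}.
  by apply: continuous_subspaceT; exact: is_derive_continuous dg.
have [c] := MVT y_gt0 (fun x _ => dg x) cg.
rewrite in_itv/= => /andP[c0 cy] gE.
(* g' c = 3 c^2 - 2 sin(c / 2)^2, and sin(c / 2) <= c / 2 *)
suff : 0 <= g y - g 0 by rewrite /g sin0 expr0n/= !subr0 subr_ge0.
rewrite gE subr0 mulr_ge0//.
have -> : cos c = 1 - 2 * sin (c / 2) ^+ 2.
  rewrite {1}(_ : c = (c / 2) *+ 2); last by rewrite mulr2n; field.
  by rewrite cos_mulr2n cos2sin2; ring.
have c2 : 0 <= c / 2 < pi.
  rewrite divr_ge0 ?ltW//=; move: c0 cy ypi; lra.
have s2 : sin (c / 2) ^+ 2 <= (c / 2) ^+ 2.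
  rewrite lerXn2r ?nnegrE ?sin_le_id//; last by case/andP: c2.
  by apply: sin_ge0_pi; case/andP: c2 => -> /ltW.
have := sqr_ge0 c; move: s2; rewrite expr_div_n; lra.
Qed.

Lemma h_ub t a : 0 <= a < 1 -> a * t + ln (sinc_pi a) <= h t.
Proof.
move=> a01; apply: ub_le_sup; last by exists a; rewrite // in_itv/=.
exists `|t| => _ [b + <-]; rewrite /= in_itv/= => b01.
have /andP[b0 b1] := b01.
rewrite -[leRHS]addr0 lerD ?ln_le0 ?sinc_pi_le1//.
apply: le_trans (ler_norm _) _; rewrite normrM ger0_norm//.
by rewrite ler_piMl// ltW.
Qed.

Lemma h_le t (b : R) :
  (forall a, 0 <= a < 1 -> a * t + ln (sinc_pi a) <= b) -> h t <= b.
Proof.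
move=> tb; apply: ge_sup.
  by exists (0 * t + ln (sinc_pi 0)); exists 0 => //; rewrite /= in_itv/= lexx ltr01.
by move=> _ [a + <-]; rewrite /= in_itv/=; exact: tb.
Qed.

Lemma h0_le0 : h (0 : R) <= 0.
Proof. by apply: h_le => a a01; rewrite mulr0 add0r ln_le0// sinc_pi_le1. Qed.

(** The term of parameter a = min(t, 1) / 64 is already positive. *)
Lemma h_gt0 t : 0 < t -> 0 < h t.
Proof.
move=> t0; pose s := Num.min t 1.
have s0 : 0 < s by rewrite lt_min t0 ltr01.
have s1 : s <= 1 by rewrite ge_min lexx orbT.
have st : s <= t by rewrite ge_min lexx.
(* pi < 4 gives sinc_pi a >= 1 - s^2/256, while e^(- a s) <= 1 / (1 + s^2/64) *)
pose a := s / 64.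
have a_gt0 : 0 < a by rewrite divr_gt0.
have a01 : 0 <= a < 1 by rewrite /a; apply/andP; split; lra.
apply: lt_le_trans (h_ub t a01).
have pi0 := @pi_gt0 R.
have pi4 : pi < 4 :> R by have := @pihalf_lt2 R; rewrite ltr_pdivrMr// -natrM.
have sinc_ge : 1 - (pi * a) ^+ 2 <= sinc_pi a.
  rewrite /sinc_pi gt_eqF// ler_pdivlMr ?mulr_gt0//.
  apply: le_trans (sin_ge_cubic _); last first.
    by rewrite mulr_ge0 ?ltW//= -[ltRHS]mulr1 ltr_pM2l//; case/andP: a01.
  by rewrite le_eqVlt; apply/orP; left; apply/eqP; ring.
have sinc0 := sinc_pi_gt0 a01.
suff : expR (- (a * t)) < sinc_pi a.
  by rewrite -[X in _ < X]lnK ?posrE// ltr_expR -subr_gt0 opprK addrC.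
apply: le_lt_trans (_ : expR (- (a * s)) < _).
  by rewrite ler_expR lerN2 ler_wpM2l// ltW.
apply: lt_le_trans sinc_ge.
have as0 : 0 < 1 + a * s by rewrite ltr_wpDr// mulr_ge0 ?ltW.
apply: le_lt_trans (_ : (1 + a * s)^-1 < _).
  by rewrite expRN lef_pV2 ?posrE ?expR_gt0// expR_ge1Dx.
rewrite -[ltLHS]mul1r ltr_pdivrMr//.
have pa : (pi * a) ^+ 2 <= s ^+ 2 / 256.
  rewrite /a; have : pi ^+ 2 <= 16 :> R.
    by rewrite (_ : 16 = 4 ^+ 2) ?lerXn2r ?nnegrE ?ltW// -natrX.
  move=> /(ler_wpM2r (sqr_ge0 (s / 64))); rewrite -exprMn => /le_trans; apply.
  by rewrite le_eqVlt; apply/orP; left; apply/eqP; field.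
have -> : a * s = s ^+ 2 / 64 by rewrite /a; field.
have s2 : s ^+ 2 <= 1 by rewrite exprn_ile1// ltW.
have s2_gt0 : 0 < s ^+ 2 by rewrite exprn_gt0.
apply: lt_le_trans (_ : (1 - s ^+ 2 / 256) * (1 + s ^+ 2 / 64) <= _).
  by move: (s ^+ 2) s2 s2_gt0 => u; nra.
by rewrite ler_pM2r ?lerD2l ?lerN2// ltr_wpDr// divr_ge0 ?ltW.
Qed.

Lemma h_conv (r : R) s t : 0 <= r <= 1 ->
  h (r * s + (1 - r) * t) <= r * h s + (1 - r) * h t.
Proof.
move=> /andP[r0 r1]; apply: h_le => a a01.
have r1' : 0 <= 1 - r by rewrite subr_ge0.
apply: le_trans (lerD (ler_wpM2l r0 (h_ub s a01)) (ler_wpM2l r1' (h_ub t a01))).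
by rewrite le_eqVlt; apply/orP; left; apply/eqP; ring.
Qed.

Lemma convex_h : convex_function (`[0, +oo[%classic : set R) (@h R).
Proof.
move=> r x y _ _; rewrite convRE.
by apply: h_conv; rewrite ge0 le1.
Qed.

(** For 0 <= s < t, convexity between 0 and t gives
    h(s) <= (s/t) h(t) + (1 - s/t) h(0) <= (s/t) h(t) < h(t). *)
Lemma increasing_h : {in `[0, +oo[ &, {homo @h R : s t / s < t}}.
Proof.
move=> s t; rewrite !in_itv/= !andbT => s0 _ st.
have t0 : 0 < t by exact: le_lt_trans st.
have st01 : 0 <= s / t <= 1.
  rewrite ler_pdivrMr// mul1r (ltW st) andbT divr_ge0//; exact: ltW.
have := h_conv t 0 st01; rewrite mulr0 addr0 divfK ?gt_eqF// => hst.
apply: le_lt_trans hst _.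
apply: le_lt_trans (_ : s / t * h t < _).
  rewrite gerDl mulr_ge0_le0 ?h0_le0// subr_ge0; by case/andP: st01.
by rewrite gtr_pMl ?h_gt0// ltr_pdivrMr// mul1r.
Qed.

End rate_function.

(** * Independence of disjoint blocks of coordinates *)

Section independent_block.
Context (d : measure_display) (T : measurableType d) (R : realType).
Context (P : probability T R) (n : nat) (g : 'I_n -> {RV P >-> R}).
Hypothesis indep_g : mutually_independent P g.
Implicit Types (J : {set 'I_n}).

(** A pi-system generating the sigma-algebra of the coordinates in J. *)
Definition cylinders J : set (set T) :=
  [set E | exists2 A : 'I_n -> set R, forall i, measurable (A i) &
     E = \bigcap_(i in [set` J]) (g i @^-1` A i)].

(** The sample space with only the events that depend on the coordinates in J:
    a function on it is measurable when it is a measurable function of the g i,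
    i in J. *)
Definition block J := g_sigma_algebraType (cylinders J).

Lemma measurable_preimage_RV i (A : set R) :
  measurable A -> measurable (g i @^-1` A).
Proof. by move=> mA; exact: measurable_funPTI. Qed.

Lemma cylinders_measurable J : cylinders J `<=` measurable.
Proof.
move=> _ [A mA ->]; apply: fin_bigcap_measurable; first exact: finite_finset.
by move=> i _; exact: measurable_preimage_RV.
Qed.

Lemma cylindersI J : setI_closed (cylinders J).
Proof.
move=> _ _ [A mA ->] [B mB ->]; exists (fun i => A i `&` B i).
  by move=> i; exact: measurableI.
by rewrite -bigcapI; apply: eq_bigcapr => i _; rewrite preimage_setI.
Qed.

Lemma cylindersT J : cylinders J setT.
Proof.
exists (fun=> setT) => //; apply/esym; rewrite -subTset => w _ i _ //.
Qed.

Lemma block_measurable_RV J i : i \in J ->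
  measurable_fun [set: block J] (g i).
Proof.
move=> iJ _ B mB; rewrite setTI; apply: sub_sigma_algebra.
exists (fun k => if k == i then B else setT).
  by move=> k; case: ifP.
apply/seteqP; split => [w Bw k _|w /(_ i iJ)]; last by rewrite /= eqxx.
by rewrite /=; case: eqVneq => // ->.
Qed.

Lemma block_measurableW J (D : T -> R) :
  measurable_fun [set: block J] D -> measurable_fun [set: T] D.
Proof.
move=> mD _ B mB; have := mD measurableT B mB.
apply: smallest_sub; last exact: cylinders_measurable.
exact: sigma_algebra_measurable.
Qed.

(** Both sides are finite measures in E which agree on cylinders, where the
    equality is the product rule for j |: J. *)
Lemma block_independent_event J j (E : set T) (B : set R) : j \notin J ->
  <<s cylinders J >> E -> measurable B ->
  (P (E `&` g j @^-1` B) = P E * P (g j @^-1` B))%E.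
Proof.
move=> jJ sE mB; set Y := g j @^-1` B.
have mY : measurable Y by exact: measurable_preimage_RV.
have q0 : 0 <= fine (P Y) by rewrite fine_ge0.
have qE : (fine (P Y))%:E = P Y by rewrite fineK ?fin_num_measure.
rewrite -[LHS]/(mrestr P mY E) muleC -qE.
rewrite -[RHS]/(mscale (NngNum q0) P E).
apply: (g_sigma_algebra_measure_unique (cylinders J) _ (fun=> setT)) => //.
- exact: cylinders_measurable.
- by move=> _; exact: cylindersT.
- by rewrite bigcup_const//; exists 0%N.
- exact: cylindersI.
- move=> _ [A mA ->]; rewrite /mrestr.
  rewrite -[RHS]/((fine (P Y))%:E * P (\bigcap_(i in [set` J]) (g i @^-1` A i)))%E qE.
  pose A' i := if i == j then B else A i.
  have mA' i : measurable (A' i) by rewrite /A'; case: ifP.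
  transitivity (P (\bigcap_(i in [set` (j |: J)%SET]) (g i @^-1` A' i))).
    congr (P _); apply/seteqP; split => [w [Aw Bw] i|w Aw].
      rewrite /= in_setU1 /A'; case: eqVneq => [->//|_ /=]; exact: Aw.
    split.
      move=> i iJ; have := Aw i; rewrite /= in_setU1 /A'.
      have /negbTE -> : i != j by apply: contraNneq jJ => <-.
      exact.
    by have := Aw j; rewrite /= setU11 /A' eqxx; exact.
  rewrite indep_g// big_setU1//= {1}/A' eqxx indep_g//; congr (_ * _)%E.
  apply: eq_bigr => i iJ; rewrite /A'.
  by have /negbTE -> : i != j by apply: contraNneq jJ => <-.
- move=> _; rewrite -[ltLHS]/(P (setT `&` Y)) setTI.
  exact: le_lt_trans (probability_le1 _ mY) (ltry _).
Qed.

(** Integrating out one coordinate: the joint law of D and g j is the product of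
    their laws, so Tonelli applies. *)
Lemma block_independent_integral J j (D : T -> R) (f : R * R -> \bar R) :
  j \notin J -> measurable_fun [set: block J] D ->
  measurable_fun setT f -> (forall z, (0 <= f z)%E) ->
  (\int[P]_w f (D w, g j w) = \int[P]_w \int[P]_v f (D w, g j v))%E.
Proof.
move=> jJ bD mf f0; have mD := block_measurableW bD.
pose X : {RV P >-> R} := HB.pack D (isMeasurableFun.Build _ _ _ _ _ mD).
pose Z w := (D w, g j w).
have mZ : measurable_fun setT Z by apply: measurable_fun_pair.
rewrite -[LHS]/(\int[P]_(w in Z @^-1` setT) (f \o Z) w)%E.
rewrite -ge0_integral_pushforward//.
transitivity (\int[distribution P X \x distribution P (g j)]_z f z)%E.
  apply: eq_measure_integral => A mA _; apply/esym.
  apply: product_measure_unique => // A1 A2 mA1 mA2.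
  rewrite -[RHS]/(P (D @^-1` A1) * P (g j @^-1` A2))%E.
  rewrite -(block_independent_event jJ)//.
  by have := bD measurableT _ mA1; rewrite setTI.
rewrite fubini_tonelli1// /fubini_F ge0_integral_distribution/=.
- apply: eq_integral => w _; rewrite ge0_integral_distribution//.
  exact: measurableT_comp.
- exact: measurable_fun_fubini_tonelli_F.
- by move=> x; exact: integral_ge0.
Qed.

End independent_block.

(** * Logistic random variables and the maximal weight *)

Section logistic_law.
Context (d : measure_display) (T : measurableType d) (R : realType).
Context (P : probability T R) (Y : {RV P >-> R}).
Local Notation mu := (@lebesgue_measure R).
Local Notation p := (@logistic_pdf R).
Hypothesis lawY : forall A : set R, measurable A ->
  distribution P Y A = logistic_prob A.

Let mp : measurable_fun setT (EFin \o p).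
Proof. by apply/measurable_EFinP; exact: measurable_logistic_pdf. Qed.

(* Lebesgue measure lives on measurableTypeR R, which has the same measurable
   sets as R but is another structure: Y is retyped accordingly *)
Let mY : measurable_fun setT (Y : T -> measurableTypeR R).
Proof. exact: measurable_funP Y. Qed.

Let Y' : {RV P >-> measurableTypeR R} :=
  HB.pack (Y : T -> measurableTypeR R) (isMeasurableFun.Build _ _ _ _ _ mY).

Let nu := distribution P Y'.

Let dom : nu `<< mu.
Proof.
apply/null_content_dominatesP => A mA muA0.
rewrite /nu/= [LHS]lawY// /logistic_prob; apply: null_set_integral => //.
exact: measurable_funS mp.
Qed.

(** The law of Y has density p with respect to Lebesgue measure, hence its
    Radon-Nikodym derivative is p almost everywhere. *)
Lemma ge0_integral_logistic_RV (f : R -> R) :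
  measurable_fun setT f -> (forall x, 0 <= f x) ->
  (\int[P]_w (f (Y w))%:E = \int[mu]_y (f y * p y)%:E)%E.
Proof.
move=> mf f0.
have mf' : measurable_fun setT (EFin \o f) by exact/measurable_EFinP.
transitivity (\int[nu]_y (EFin \o f) y)%E.
  by rewrite ge0_integral_distribution// => y; rewrite lee_fin.
rewrite -(Radon_Nikodym_SigmaFinite.change_of_variables dom)//.
apply: ae_eq_integral => //.
- apply: emeasurable_funM => //.
  exact: measurable_int (Radon_Nikodym_SigmaFinite.f_integrable dom).
- apply/measurable_EFinP/measurable_funM => //; exact: measurable_logistic_pdf.
under [X in ae_eq _ _ _ X]eq_fun do rewrite EFinM.
apply: ae_eqe_mul2l; apply: integral_ae_eq => //.
- exact: Radon_Nikodym_SigmaFinite.f_integrable.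
- move=> E _ mE; rewrite -Radon_Nikodym_SigmaFinite.f_integral//.
  exact: lawY.
Qed.

End logistic_law.

Section max_weight_theory.
Context (R : realType) (n : nat).
Implicit Types (X : {set {set 'I_n}}) (w : 'I_n -> R).

Lemma max_weight_attained X w : X != finset.set0 ->
  exists2 x, x \in X & max_weight X w = \sum_(i in x) w i.
Proof.
case/set0Pn => x0 x0X; rewrite /max_weight.
have [|x xX ->] := @eq_bigmax _ (\bar R) _ -oo%E x0 (mem X)
  (fun x : {set 'I_n} => (\sum_(i in x) w i)%:E) x0X.
  by move=> x _; exact: leNye.
by exists x.
Qed.

Lemma sum_le_max_weight X w (x : {set 'I_n}) : x \in X ->
  \sum_(i in x) w i <= max_weight X w.
Proof.
move=> xX; have X0 : X != finset.set0 by apply/set0Pn; exists x.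
rewrite -lee_fin.
have := @le_bigmax_cond _ (\bar R) _ -oo%E x (mem X)
  (fun x : {set 'I_n} => (\sum_(i in x) w i)%:E) xX.
move/le_trans; apply; rewrite /max_weight.
have [|y yX ->//] := @eq_bigmax _ (\bar R) _ -oo%E x (mem X)
  (fun x : {set 'I_n} => (\sum_(i in x) w i)%:E) xX.
by move=> ? _; exact: leNye.
Qed.

Lemma max_weight_eq X w (m : R) (x : {set 'I_n}) :
  x \in X -> m = \sum_(i in x) w i ->
  (forall y, y \in X -> \sum_(i in y) w i <= m) -> max_weight X w = m.
Proof.
move=> xX mE Xm; have X0 : X != finset.set0 by apply/set0Pn; exists x.
apply/eqP; rewrite eq_le {2}mE sum_le_max_weight// andbT.
by have [y yX ->] := max_weight_attained w X0; exact: Xm.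
Qed.

Lemma measurable_max_weight d (T : measurableType d) (u : 'I_n -> T -> R) X :
  (forall x i, x \in X -> i \in x -> measurable_fun setT (u i)) ->
  measurable_fun setT (fun t => max_weight X (u ^~ t)).
Proof.
move=> mu; rewrite /max_weight; apply: measurableT_comp => //.
under eq_fun do rewrite -big_enum/=.
have : {subset enum X <= X} by move=> x; rewrite mem_enum.
elim: (enum X) => [|x s IH] sX.
  by under eq_fun do rewrite big_nil; exact: measurable_cst.
under eq_fun do rewrite big_cons.
apply: measurable_maxe; last first.
  by apply: IH => y ys; apply: sX; rewrite inE ys orbT.
apply/measurable_EFinP; under eq_fun do rewrite big_mkcond/=.
apply: measurable_sum => i.
have [ix|_] := boolP (i \in x); last exact: measurable_cst.
by apply: mu ix; apply: sX; rewrite inE eqxx.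
Qed.

End max_weight_theory.

(** * Splitting a family at a coordinate *)

Section split_family.
Context (R : realType) (n : nat).
Implicit Types (X : {set {set 'I_n}}) (w : 'I_n -> R) (j : 'I_n).

(** The deletion and the link of j in the family X. *)
Definition without j X : {set {set 'I_n}} := [set x in X | j \notin x]%SET.
Definition link j X : {set {set 'I_n}} :=
  [set (x :\ j)%SET | x in X & j \in x]%SET.

Lemma card_without_link j X : #|X| = (#|without j X| + #|link j X|)%N.
Proof.
rewrite /link card_in_imset; last first.
  move=> x y; rewrite !inE => /andP[_ jx] /andP[_ jy] xy.
  by rewrite -(finset.setD1K jx) -(finset.setD1K jy) xy.
rewrite -(cardsID [set x : {set 'I_n} | j \notin x]%SET X).
congr (_ + _)%N; apply: eq_card => x.
  by rewrite !inE.
by rewrite !inE negbK andbC.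
Qed.

Lemma without_sub j X x : x \in without j X -> x \in X.
Proof. by rewrite inE => /andP[]. Qed.

Lemma link_add j X x : x \in link j X -> j \notin x /\ (j |: x)%SET \in X.
Proof.
case/imsetP => y; rewrite inE => /andP[yX jy] ->.
by rewrite finset.setD11 finset.setD1K.
Qed.

Lemma split_family j X x : x \in X ->
  (x \in without j X) \/ (exists2 y, y \in link j X & x = (j |: y)%SET /\ j \notin y).
Proof.
move=> xX; have [jx|jx] := boolP (j \in x); last by left; rewrite inE xX.
right; exists (x :\ j)%SET; last by rewrite finset.setD1K// finset.setD11.
by apply/imsetP; exists x; rewrite // inE xX.
Qed.

Lemma sum_add j w (y : {set 'I_n}) : j \notin y ->
  \sum_(i in (j |: y)%SET) w i = w j + \sum_(i in y) w i.
Proof. by move=> jy; rewrite big_setU1. Qed.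

Lemma max_weight_split j X w :
  without j X != finset.set0 -> link j X != finset.set0 ->
  max_weight X w = max_weight (without j X) w +
    Num.max (max_weight (link j X) w - max_weight (without j X) w + w j) 0.
Proof.
move=> X00 X10; set a := max_weight (without j X) w.
set b := max_weight (link j X) w.
have [x0 x0X a_eq] := max_weight_attained w X00.
have [x1 x1X b_eq] := max_weight_attained w X10.
have [jx1 jx1X] := link_add x1X.
have ub y : y \in X -> \sum_(i in y) w i <= a + Num.max (b - a + w j) 0.
  case/(split_family j) => [yX|[z zX [-> jz]]].
    by rewrite ler_wpDr ?sum_le_max_weight// le_max lexx orbT.
  rewrite sum_add//; apply: (@le_trans _ _ (b + w j)).
    by rewrite addrC lerD2r sum_le_max_weight.
  by rewrite -lerBlDl -addrAC le_max lexx.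
have [ba|ba] := leP (b - a + w j) 0.
  rewrite addr0; apply: (max_weight_eq (without_sub x0X) a_eq) => y /ub.
  by rewrite (max_r ba) addr0.
have -> : a + (b - a + w j) = b + w j by ring.
apply: (max_weight_eq jx1X); first by rewrite sum_add// -b_eq addrC.
move=> y /ub; rewrite (max_l (ltW ba)).
by have -> : a + (b - a + w j) = b + w j by ring.
Qed.

Lemma max_weight_link j X w :
  without j X = finset.set0 -> X != finset.set0 ->
  max_weight X w = max_weight (link j X) w + w j.
Proof.
move=> X00 /set0Pn[x0 x0X].
have key x : x \in X -> exists2 y, y \in link j X & x = (j |: y)%SET /\ j \notin y.
  by case/(split_family j) => //; rewrite X00 inE.
have L0 : link j X != finset.set0.
  by have [y yL _] := key _ x0X; apply/set0Pn; exists y.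
have [y yL b_eq] := max_weight_attained w L0.
have [jy jyX] := link_add yL.
apply: (max_weight_eq jyX); first by rewrite sum_add// -b_eq addrC.
move=> x /key[z zL [-> jz]].
by rewrite sum_add// addrC lerD2r sum_le_max_weight.
Qed.

End split_family.

(** * The lower bound on the expected maximal weight *)

Section softplus.
Context {R : realType}.
Implicit Types x c : R.

Definition softplus x : R := ln (1 + expR x).

Lemma softplus_ge0 x : 0 <= softplus x.
Proof. by rewrite ln_ge0// lerDl expR_ge0. Qed.

Lemma expR_softplus x : expR (softplus x) = 1 + expR x.
Proof. by rewrite lnK// posrE addr_gt0 ?expR_gt0. Qed.

Lemma measurable_softplus : measurable_fun setT softplus.
Proof.
apply: continuous_measurable_fun.
have e0 (x : R) : 0 < 1 + expR x by rewrite addr_gt0 ?expR_gt0.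
have ds (x : R) := der_comp (derD (is_derive_cst (1 : R) x 1) (is_derive_expR x))
  (is_derive1_ln (e0 x)).
exact: is_derive_continuous ds.
Qed.

(** Convexity of ln (1 + e^x), in the form used for Jensen's inequality. *)
Lemma softplus_tangent c x :
  softplus c + expR c / (1 + expR c) * (x - c) <= softplus x.
Proof.
have e0 (y : R) : 0 < 1 + expR y by rewrite addr_gt0 ?expR_gt0.
set q := expR c / (1 + expR c).
have q01 : 0 <= q <= 1.
  by rewrite divr_ge0 ?expR_ge0 ?(ltW (e0 c))//= ler_pdivrMr// mul1r lerDr.
rewrite -ler_expR expRD !expR_softplus.
apply: le_trans (ler_wpM2l (ltW (e0 c)) (expR_chord (x - c) q01)) _.
rewrite expRD expRN /q le_eqVlt; apply/orP; left; apply/eqP.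
have := e0 c; have := expR_gt0 c; move: (expR c) (expR x) => u v u0 u1.
by field; rewrite !gt_eqF.
Qed.

End softplus.

Section logistic_sample.
Context (d : measure_display) (T : measurableType d) (R : realType).
Context (P : probability T R) (n : nat) (g : 'I_n -> {RV P >-> R}).
Hypothesis iid_g : iid_sample P logistic_prob g.
Implicit Types (X : {set {set 'I_n}}) (J : {set 'I_n}).
Local Notation mu := (@lebesgue_measure R).

Let indep_g : mutually_independent P g := iid_g.1.
Let law_g i : forall A : set R, measurable A ->
  distribution P (g i) A = logistic_prob A := iid_g.2 i.

Definition weight X (w : T) : R := max_weight X (fun i => g i w).

Lemma GammaE X : Gamma P g X = (\int[P]_w weight X w)%R.
Proof. by rewrite /Gamma unlock. Qed.

Lemma integral_shift_pospart j c :
  (\int[P]_w (Num.max (c + g j w) 0)%:E = (softplus c)%:E)%E.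
Proof.
rewrite -integral_pospart_logistic.
apply: (ge0_integral_logistic_RV (law_g j) (f := fun y => Num.max (c + y) 0)).
- by apply: measurable_maxr => //; exact: measurable_funD.
- by move=> x; rewrite le_max lexx orbT.
Qed.

Lemma integral_negpart j :
  (\int[P]_w (Num.max (- g j w) 0)%:E = (softplus (0 : R))%:E)%E.
Proof.
rewrite -(integral_shift_pospart j).
have mf : measurable_fun setT (fun y : R => Num.max (0 + y) 0).
  by apply: measurable_maxr => //; exact: measurable_funD.
rewrite (ge0_integral_logistic_RV (law_g j) (f := fun y => Num.max (- y) 0)).
- rewrite (ge0_integral_logistic_RV (law_g j) mf).
    rewrite -integral_opp.
    + by apply: eq_integral => y _; rewrite add0r opprK logistic_pdfN.
    + apply: measurable_funM; last exact: measurable_logistic_pdf.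
      by apply: measurable_maxr => //; exact: oppr_measurable.
    + by move=> x; rewrite mulr_ge0 ?logistic_pdf_ge0// le_max lexx orbT.
  by move=> x; rewrite le_max lexx orbT.
- by apply: measurable_maxr => //; exact: oppr_measurable.
- by move=> x; rewrite le_max lexx orbT.
Qed.

Lemma ge0_integrable_fin (f : T -> R) (r : R) :
  measurable_fun setT f -> (forall w, 0 <= f w) ->
  (\int[P]_w (f w)%:E <= r%:E)%E -> P.-integrable setT (EFin \o f).
Proof.
move=> mf f0 fr; apply/integrableP; split; first exact/measurable_EFinP.
under eq_integral do rewrite /= ger0_norm//.
exact: le_lt_trans fr (ltry r).
Qed.

Let pos j w : R := Num.max (0 + g j w) 0.
Let neg j w : R := Num.max (- g j w) 0.

Let integrable_pos j : P.-integrable setT (EFin \o pos j).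
Proof.
apply: (@ge0_integrable_fin _ (softplus 0)).
- by apply: measurable_maxr => //; exact: measurable_funD.
- by move=> w; rewrite le_max lexx orbT.
- by rewrite integral_shift_pospart.
Qed.

Let integrable_neg j : P.-integrable setT (EFin \o neg j).
Proof.
apply: (@ge0_integrable_fin _ (softplus 0)).
- by apply: measurable_maxr => //; exact: measurableT_comp.
- by move=> w; rewrite le_max lexx orbT.
- by rewrite integral_negpart.
Qed.

Let gE j w : g j w = pos j w - neg j w.
Proof.
rewrite /pos /neg add0r; have [g0|g0] := leP (g j w) 0.
  by rewrite max_l ?oppr_ge0// opprK add0r.
by rewrite max_r ?subr0// oppr_le0 ltW.
Qed.

Lemma integrable_RV j : P.-integrable setT (EFin \o g j).
Proof.
have := integrableB measurableT (integrable_pos j) (integrable_neg j).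
by apply: eq_integrable => // w _; rewrite /= gE.
Qed.

(** Needed for families all of whose members contain j, where deleting j changes
    the maximal weight by exactly g j. *)
Lemma Rintegral_RV j : (\int[P]_w g j w)%R = 0.
Proof.
under eq_Rintegral do rewrite gE.
rewrite RintegralB// /Rintegral integral_shift_pospart integral_negpart.
by rewrite subrr.
Qed.

Lemma measurable_weight X : measurable_fun setT (weight X).
Proof.
apply: (@measurable_max_weight _ _ _ T (fun i => g i)) => x i _ _.
exact: measurable_funP.
Qed.

Lemma block_measurable_weight J X : (forall x, x \in X -> x \subset J) ->
  measurable_fun [set: block g J] (weight X).
Proof.
move=> XJ; apply: (@measurable_max_weight _ _ _ (block g J)) => x i xX ix.
apply: block_measurable_RV; exact: (fintype.subsetP (XJ x xX)).
Qed.

Lemma integrable_weight X : X != finset.set0 ->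
  P.-integrable setT (EFin \o weight X).
Proof.
move=> X0.
have : P.-integrable setT (fun w => \sum_(i < n) (`|g i w|)%:E)%E.
  apply: integrable_sum => // i _.
  exact: integrable_abse (integrable_RV i).
apply: le_integrable => //; first by apply/measurable_EFinP; exact: measurable_weight.
move=> w _ /=; rewrite sumEFin /= lee_fin [leRHS]ger0_norm ?sumr_ge0//.
rewrite /weight; have [x xX ->] := max_weight_attained (fun i => g i w) X0.
apply: le_trans (ler_norm_sum _ _ _) _.
by rewrite big_mkcond/= ler_sum// => i _; case: ifP.
Qed.

(** Write the maximal weight as A + max(D + g j, 0) with D = B - A.  The
    coordinate j is independent of D, so integrating it out replaces the second
    term by softplus D, to which Jensen applies. *)
Lemma Gamma_split j J X : j \notin J ->
  (forall x, x \in X -> x \subset (j |: J)%SET) ->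
  without j X != finset.set0 -> link j X != finset.set0 ->
  Gamma P g (without j X) +
    softplus (Gamma P g (link j X) - Gamma P g (without j X)) <= Gamma P g X.
Proof.
move=> jJ XJ A0 B0; set A := without j X; set B := link j X.
have subJ x : x \in X -> j \notin x -> x \subset J.
  move=> /XJ xJ jx; apply/fintype.subsetP => i ix.
  have := fintype.subsetP xJ i ix; rewrite in_setU1 => /predU1P[ij|//].
  by rewrite -ij ix in jx.
have AJ x : x \in A -> x \subset J.
  by rewrite inE => /andP[]; exact: subJ.
have BJ x : x \in B -> x \subset J.
  move=> /link_add[jx /XJ/fintype.subsetP xJ]; apply/fintype.subsetP => i ix.
  have := xJ i; rewrite !in_setU1 ix orbT => /(_ isT)/predU1P[ij|//].
  by rewrite -ij ix in jx.
pose D w := weight B w - weight A w.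
have bD : measurable_fun [set: block g J] D.
  by apply: measurable_funB; exact: block_measurable_weight.
have mD := block_measurableW bD.
have iA := integrable_weight A0; have iB := integrable_weight B0.
have iD : P.-integrable setT (EFin \o D).
  by have := integrableB measurableT iB iA; apply: eq_integrable.
pose S w : R := Num.max (D w + g j w) 0.
have wE w : weight X w = weight A w + S w by exact: max_weight_split.
have X0 : X != finset.set0.
  by have /set0Pn[x /without_sub xX] := A0; apply/set0Pn; exists x.
have iX := integrable_weight X0.
have iS : P.-integrable setT (EFin \o S).
  have := integrableB measurableT iX iA; apply: eq_integrable => // w _.
  by rewrite /= wE -EFinB addrAC subrr add0r.
have SE : (\int[P]_w (S w)%:E = \int[P]_w (softplus (D w))%:E)%E.
  pose f (z : R * R) : \bar R := (Num.max (z.1 + z.2) 0)%:E.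
  rewrite (@block_independent_integral _ _ _ _ _ _ indep_g J j D f)//.
  - by apply: eq_integral => w _; rewrite integral_shift_pospart.
  - apply/measurable_EFinP; apply: measurable_maxr => //.
    by apply: measurable_funD.
  - by move=> z; rewrite lee_fin le_max lexx orbT.
have iSD : P.-integrable setT (EFin \o (softplus \o D)).
  apply: (@ge0_integrable_fin _ (\int[P]_w S w)%R).
  - by apply: measurableT_comp => //; exact: measurable_softplus.
  - by move=> w; exact: softplus_ge0.
  - by rewrite -SE /Rintegral fineK//; exact: integrable_fin_num iS.
have GX : Gamma P g X = Gamma P g A + (\int[P]_w softplus (D w))%R.
  rewrite !GammaE; under eq_Rintegral do rewrite wE.
  by rewrite RintegralD//; congr (_ + _); rewrite /Rintegral SE.
rewrite GX lerD2l; set c := Gamma P g B - Gamma P g A.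
have cE : (\int[P]_w D w)%R = c by rewrite RintegralB// -!GammaE.
set q := expR c / (1 + expR c).
have icst (r : R) : P.-integrable setT (EFin \o cst r).
  exact: finite_measure_integrable_cst.
have icr (r : R) : P.-integrable setT (EFin \o (fun w => r * (D w - c))).
  have := integrableZl measurableT r (integrableB measurableT iD (icst c)).
  by apply: eq_integrable.
have : (\int[P]_w (softplus c + q * (D w - c)) <= \int[P]_w softplus (D w))%R.
  apply: le_Rintegral => //.
    have := integrableD measurableT (icst (softplus c)) (icr q).
    by apply: eq_integrable.
  by move=> w _; exact: softplus_tangent.
apply: le_trans; rewrite RintegralD//; last exact: icst.
rewrite RintegralZl//; last first.
  by have := integrableB measurableT iD (icst c); apply: eq_integrable.
rewrite RintegralB//; last exact: icst.
have PT : fine (P setT) = 1 by rewrite probability_setT.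
by rewrite cE !Rintegral_cst// [fine _]PT !mulr1 subrr mulr0 addr0.
Qed.

Lemma Gamma_link j X : without j X = finset.set0 -> X != finset.set0 ->
  Gamma P g X = Gamma P g (link j X).
Proof.
move=> A0 X0; rewrite !GammaE.
have B0 : link j X != finset.set0.
  by move: X0; rewrite -!card_gt0 (card_without_link j X) A0 cards0 add0n.
under eq_Rintegral do rewrite /weight (max_weight_link _ A0 X0).
rewrite RintegralD//; last 2 first.
- exact: integrable_weight.
- exact: integrable_RV.
by rewrite Rintegral_RV addr0.
Qed.

(** Induction on the number of coordinates in J.  In exponential form the bound
    of Gamma_split is e^Gamma(X) >= e^Gamma(X0) + e^Gamma(X1), which matches
    |X| = |X0| + |X1|. *)
Lemma card_le_expR_Gamma J X : X != finset.set0 ->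
  (forall x, x \in X -> x \subset J) -> #|X|%:R <= expR (Gamma P g X).
Proof.
have [k kJ] := ubnP #|J|; elim: k => // k IH in J X kJ *; move=> X0 XJ.
have [J0|[j jJ]] := set_0Vmem J.
  have Xs x : x \in X -> x = finset.set0.
    by move=> /XJ; rewrite J0 finset.subset0 => /eqP.
  have -> : Gamma P g X = 0.
    rewrite GammaE.
    rewrite (_ : weight X = cst 0) ?Rintegral_cst// ?mul0r//.
    apply/funext => w; rewrite /weight.
    by have [x /Xs-> ->] := max_weight_attained (fun i => g i w) X0; rewrite big_set0.
  rewrite expR0 lern1 -(cards1 (finset.set0 : {set 'I_n})).
  by apply/subset_leq_card/fintype.subsetP => x /Xs ->; rewrite inE.
pose J' := (J :\ j)%SET.
have jJ' : j \notin J' by rewrite finset.setD11.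
have JE : (j |: J')%SET = J by rewrite finset.setD1K.
have J'k : (#|J'| < k)%N by move: kJ; rewrite (cardsD1 j J) jJ.
have subJ (x : {set 'I_n}) : x \subset J -> j \notin x -> x \subset J'.
  by move=> xJ jx; rewrite /J' finset.subsetD1 xJ.
have AJ x : x \in without j X -> x \subset J'.
  by rewrite inE => /andP[/XJ xJ jx]; exact: subJ.
have BJ x : x \in link j X -> x \subset J'.
  move=> /link_add[jx /XJ]; rewrite finset.subUset => /andP[_ xJ]; exact: subJ.
rewrite (card_without_link j X).
have [A0|A0] := eqVneq (without j X) finset.set0.
  rewrite A0 cards0 add0n (Gamma_link A0 X0); apply: (IH J') => //.
  by rewrite -card_gt0; move: X0; rewrite -card_gt0 (card_without_link j X) A0 cards0.
have [B0|B0] := eqVneq (link j X) finset.set0.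
  rewrite B0 cards0 addn0.
  have XE : X = without j X.
    apply/esym/eqP; rewrite eqEcard; apply/andP; split.
      by apply/fintype.subsetP => x; exact: without_sub.
    by rewrite (card_without_link j X) B0 cards0 addn0.
  by rewrite {2}XE; exact: (IH J').
rewrite natrD.
have XJ' x : x \in X -> x \subset (j |: J')%SET by rewrite JE; exact: XJ.
apply: le_trans (_ : expR (Gamma P g (without j X) +
  softplus (Gamma P g (link j X) - Gamma P g (without j X))) <= _); last first.
  by rewrite ler_expR (Gamma_split jJ').
rewrite expRD expR_softplus mulrDr mulr1 -expRD [_ + (_ - _)]addrCA subrr addr0.
by rewrite lerD//; exact: (IH J').
Qed.

Lemma ln_card_le_Gamma X : X != finset.set0 -> ln (#|X|%:R : R) <= Gamma P g X.
Proof.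
move=> X0; rewrite -ler_expR lnK ?posrE ?ltr0n ?card_gt0//.
by apply: (@card_le_expR_Gamma [set: 'I_n]) => // x _; exact: finset.subsetT.
Qed.

End logistic_sample.

(** * The exponential moment bound *)

Section exponential_moment.
Context (d : measure_display) (T : measurableType d) (R : realType).
Context (P : probability T R) (n : nat) (g : 'I_n -> {RV P >-> R}).
Hypothesis iid_g : iid_sample P logistic_prob g.
Implicit Types (X : {set {set 'I_n}}) (J : {set 'I_n}) (a : R).

Let indep_g : mutually_independent P g := iid_g.1.
Let law_g i : forall A : set R, measurable A ->
  distribution P (g i) A = logistic_prob A := iid_g.2 i.

Lemma measurable_expR_scale a : measurable_fun setT (fun y : R => expR (a * y)).
Proof.
apply: continuous_measurable_fun.
exact: is_derive_continuous (fun x => der_expR_scale x a).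
Qed.

Lemma mgf_RV i a : (\int[P]_w (expR (a * g i w))%:E = tilted_moment 1 a)%E.
Proof.
rewrite (ge0_integral_logistic_RV (law_g i) (measurable_expR_scale a)).
  by [].
by move=> x; exact: expR_ge0.
Qed.

Lemma measurable_block_sum J J' : J \subset J' ->
  measurable_fun [set: block g J'] (fun w => \sum_(i in J) g i w).
Proof.
move=> /fintype.subsetP JJ'; under eq_fun do rewrite big_mkcond/=.
apply: measurable_sum => i.
have [iJ|_] := boolP (i \in J); last exact: measurable_cst.
by apply: block_measurable_RV; exact: JJ'.
Qed.

Lemma mgf_sum J a : 0 <= a < 1 ->
  (\int[P]_w (expR (a * \sum_(i in J) g i w))%:E =
   (fine (tilted_moment 1 a) ^+ #|J|)%:E)%E.
Proof.
move=> a01; set m := fine _.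
have mE : m%:E = tilted_moment 1 a by rewrite fineK// tilted_moment_fin.
have [k kJ] := ubnP #|J|; elim: k => // k IH in J kJ *.
have [->|[j jJ]] := set_0Vmem J.
  under eq_integral do rewrite big_set0 mulr0 expR0.
  by rewrite integral_cst// [X in (_ * X)%E](probability_setT P) mule1 cards0.
pose J' := (J :\ j)%SET.
have jJ' : j \notin J' by rewrite finset.setD11.
have JE : (j |: J')%SET = J by rewrite finset.setD1K.
pose D w := \sum_(i in J') g i w.
have bD : measurable_fun [set: block g J'] D by exact: measurable_block_sum.
pose f (z : R * R) : \bar R := (expR (a * z.1) * expR (a * z.2))%:E.
transitivity (\int[P]_w f (D w, g j w))%E.
  apply: eq_integral => w _; rewrite /f -expRD -mulrDr -JE sum_add//.
  by rewrite addrC.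
rewrite (block_independent_integral indep_g jJ' bD)//; first last.
- by move=> z; rewrite lee_fin mulr_ge0 ?expR_ge0.
- apply/measurable_EFinP; apply: measurable_funM.
    exact: (measurableT_comp (measurable_expR_scale a)).
  exact: (measurableT_comp (measurable_expR_scale a)).
have mexp (Y : T -> R) : measurable_fun setT Y ->
    measurable_fun setT (fun w => (expR (a * Y w))%:E).
  move=> mY; apply/measurable_EFinP.
  exact: (measurableT_comp (measurable_expR_scale a)).
have e0 (Y : T -> R) w : [set: T] w -> (0 <= (expR (a * Y w))%:E)%E.
  by move=> _; rewrite lee_fin expR_ge0.
transitivity (\int[P]_w (m%:E * (expR (a * D w))%:E))%E.
  apply: eq_integral => w _; rewrite /f/= muleC mE -(mgf_RV j).
  rewrite -ge0_integralZl_EFin//; first exact: mexp.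
rewrite ge0_integralZl_EFin//; last 2 first.
- exact/mexp/(block_measurableW bD).
- by rewrite fine_ge0 ?tilted_moment_ge0.
have J'k : (#|J'| < k)%N by move: kJ; rewrite (cardsD1 j J) jJ.
by rewrite (IH _ J'k) -EFinM -exprS (cardsD1 j J) jJ.
Qed.

(** Jensen's inequality, through the tangent to exp at a Gamma(X); then the
    exponential of a maximum is at most the sum of the exponentials. *)
Lemma expR_Gamma_le X (k : nat) a : X != finset.set0 ->
  (forall x, x \in X -> #|x| = k) -> 0 <= a < 1 ->
  expR (a * Gamma P g X) <= #|X|%:R * fine (tilted_moment 1 a) ^+ k.
Proof.
move=> X0 Xk a01; have /andP[a0 _] := a01; set m := fine _.
pose e w : R := expR (a * weight g X w).
have me : measurable_fun setT e.
  exact: (measurableT_comp (measurable_expR_scale a) (measurable_weight g X)).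
have mS (x : {set 'I_n}) :
    measurable_fun setT (fun w => (expR (a * \sum_(i in x) g i w))%:E).
  apply/measurable_EFinP; apply: (measurableT_comp (measurable_expR_scale a)).
  exact: (block_measurableW (measurable_block_sum (fintype.subxx x))).
have eX : (\int[P]_w (e w)%:E <= (#|X|%:R * m ^+ k)%:E)%E.
  apply: (@le_trans _ _ (\int[P]_w
      \sum_(x <- enum X) (expR (a * \sum_(i in x) g i w))%:E)%E).
    apply: ge0_le_integral => //.
    - by move=> w _; rewrite lee_fin expR_ge0.
    - exact/measurable_EFinP.
    - exact: emeasurable_sum.
    - move=> w _; rewrite /e /weight sumEFin lee_fin.
      have [x xX ->] := max_weight_attained (fun i => g i w) X0.
      by rewrite big_enum/= (bigD1 x)//= lerDl sumr_ge0// => y _.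
  rewrite ge0_integral_sum//.
  rewrite big_enum/= (eq_bigr (fun=> (m ^+ k)%:E)); last first.
    by move=> x xX; rewrite mgf_sum// Xk.
  by rewrite sumEFin sumr_const mulr_natl.
have ie : P.-integrable setT (EFin \o e).
  by apply: (ge0_integrable_fin me) eX => w; exact: expR_ge0.
have iX := integrable_weight iid_g X0.
set c := Gamma P g X.
have icst (r : R) : P.-integrable setT (EFin \o cst r).
  exact: finite_measure_integrable_cst.
have iXc : P.-integrable setT (EFin \o (fun w => weight g X w - c)).
  by have := integrableB measurableT iX (icst c); apply: eq_integrable.
have iZ : P.-integrable setT (EFin \o (fun w => expR (a * c) * a * (weight g X w - c))).
  by have := integrableZl measurableT (expR (a * c) * a) iXc; apply: eq_integrable.
have PT : fine (P setT) = 1 by rewrite probability_setT.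
apply: (@le_trans _ _ (\int[P]_w e w)%R); last first.
  by rewrite -lee_fin /Rintegral fineK//; exact: integrable_fin_num ie.
apply: (@le_trans _ _ (\int[P]_w
    (expR (a * c) + expR (a * c) * a * (weight g X w - c)))%R).
  rewrite RintegralD//; last exact: icst.
  rewrite RintegralZl// RintegralB//; last exact: icst.
  by rewrite -GammaE !Rintegral_cst// [fine _]PT !mulr1 subrr mulr0 addr0.
apply: le_Rintegral => //.
  by have := integrableD measurableT (icst (expR (a * c))) iZ; apply: eq_integrable.
move=> w _; rewrite -mulrA -[X in X + _]mulr1 -mulrDr.
rewrite [leRHS](_ : _ = expR (a * c) * expR (a * (weight g X w - c))).
  by rewrite ler_pM2l ?expR_gt0// expR_ge1Dx.
by rewrite -expRD -mulrDr addrC subrK.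
Qed.

Lemma h_Gamma_le X (k : nat) : (0 < k)%N -> X != finset.set0 ->
  (forall x, x \in X -> #|x| = k) ->
  h (k%:R^-1 * Gamma P g X) <= k%:R^-1 * ln (#|X|%:R : R).
Proof.
move=> k0 X0 Xk; apply: h_le => a a01.
have s0 := sinc_pi_gt0 a01.
have kR : 0 < k%:R :> R by rewrite ltr0n.
have X_gt0 : 0 < #|X|%:R :> R by rewrite ltr0n card_gt0.
have main : expR (a * Gamma P g X) * sinc_pi a ^+ k <= #|X|%:R.
  apply: le_trans (ler_wpM2r (exprn_ge0 k (ltW s0)) (expR_Gamma_le X0 Xk a01)) _.
  rewrite -mulrA -exprMn ler_piMr ?(ltW X_gt0)// exprn_ile1 ?logistic_mgf_sinc//.
  by rewrite mulr_ge0 ?fine_ge0 ?tilted_moment_ge0 ?(ltW s0).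
have sk0 : 0 < sinc_pi a ^+ k by rewrite exprn_gt0.
have : a * Gamma P g X + ln (sinc_pi a) *+ k <= ln #|X|%:R.
  by rewrite -ler_expR lnK ?posrE// expRD -lnXn// lnK ?posrE.
move=> /(ler_wpM2l (_ : 0 <= k%:R^-1)) H; apply: le_trans (H _); last first.
  by rewrite invr_ge0 ltW.
rewrite mulrDr -[ln (sinc_pi a) *+ k]mulr_natl mulKf ?gt_eqF//.
by rewrite mulrCA.
Qed.

End exponential_moment.

Theorem theorem3p1 (R : realType) :
  (forall (d : measure_display) (T : measurableType d) (P : probability T R)
     (n : nat) (g : 'I_n -> {RV P >-> R}) (X : {set {set 'I_n}}),
     (1 <= n)%N -> iid_sample P logistic_prob g -> X != finset.set0 ->
     ln (#|X|%:R : R) <= Gamma P g X) /\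
  [/\ convex_function (`[0, +oo[%classic : set R) (@h R),
      {in `[0, +oo[ &, {homo @h R : s t / s < t}} &
      forall (d : measure_display) (T : measurableType d)
        (P : probability T R) (n k : nat) (g : 'I_n -> {RV P >-> R})
        (X : {set {set 'I_n}}),
        (1 <= k <= n)%N -> iid_sample P logistic_prob g -> X != finset.set0 ->
        (forall x, x \in X -> #|x| = k) ->
        let t := k%:R^-1 * Gamma P g X in
        h t <= k%:R^-1 * ln (#|X|%:R : R)].
Proof.
split; first by move=> d T P n g X _ iid_g; exact: ln_card_le_Gamma.
split; [exact: convex_h | exact: increasing_h |].
by move=> d T P n k g X /andP[k0 _] iid_g; exact: h_Gamma_le.
Qed.
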